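(* Let $M$ be a dual operator system and let $\phi:M\to M$ be a UP map. Then $\phi$ has an asymptotic lift. Moreover, if $(N_1,\alpha_1,E_1)$ and $(N_2,\alpha_2,E_2)$ are two asymptotic lifts of $\phi$, then there is a unique UP-isomorphism of dual operator systems $\theta:N_1\to N_2$ such that $\theta\circ\alpha_1=\alpha_2\circ\theta$ and $E_2\circ\theta=E_1$.
   Context: A dual operator system is a self-adjoint ($M^*=M$) linear space of operators $M\subseteq\mathcal B(H)$ on a Hilbert space $H$ that contains the identity $\mathbf 1$ and is closed in the weak$^*$ (ultraweak) topology of $\mathcal B(H)$. It is the dual of a predual $M_*$, identified with the weak$^*$-continuous linear functionals on $M$. A linear map between dual operator systems is normal if it is weak$^*$-continuous. A UP map is a normal, unit-preserving, positive linear map between dual operator systems. A UP-isomorphism is a bijective UP map whose inverse is also a UP map; a UP automorphism is a UP-isomorphism of a dual operator system onto itself. For a dual operator system $M$, $M^{\rm sa}$ denotes its real Banach space of self-adjoint elements. A reversible lift of a UP map $\phi:M\to M$ is a triple $(N,\alpha,E)$ consisting of a dual operator system $N$, a UP automorphism $\alpha:N\to N$, and a UP map $E:N\to M$ satisfying $E\circ\alpha=\phi\circ E$. It is nondegenerate if, for $y\in N$, $E(\alpha^{-n}(y))=0$ for all $n=0,1,2,\dots$ implies $y=0$. An asymptotic lift of $\phi$ is a nondegenerate reversible lift $(N,\alpha,E)$ of $\phi$ such that $$\|\rho\circ E\restriction_{N^{\rm sa}}\|=\lim_{k\to\infty}\|\rho\circ\phi^k\restriction_{M^{\rm sa}}\|,\qquad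 \rho\in M_*.$$ *)

(* Defs.v *)
From HB Require Import structures.
From mathcomp Require Import all_boot all_order all_algebra.
From mathcomp Require Import complex.
From mathcomp Require Import all_classical all_reals all_analysis.

Set Implicit Arguments.
Unset Strict Implicit.
Unset Printing Implicit Defensive.

Import Order.TTheory GRing.Theory Num.Theory.
Import numFieldNormedType.Exports.

Local Open Scope classical_set_scope.
Local Open Scope ring_scope.

(* The inner product is linear in its first argument and conjugate-linear in
   its second one. *)
Record hilbertSpace (R : realType) := HilbertSpace {
  hilbert_sort :> completeNormedModType R[i];
  inner : {dot hilbert_sort for @Num.conj R[i]};
  hilbert_normE : forall x, `|x| ^+ 2 = inner x x
}.

Arguments inner {R h}.

(* In a normed space over R[i] the norm `|x| is an element of R[i]. *)
Definition rnorm (R : realType) (V : normedZmodType R[i]) (x : V) : R :=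
  complex.Re `|x|.

Section BoundedOperators.
Variables (R : realType) (H : hilbertSpace R).

Definition bounded_operator : set (H -> H) :=
  [set f | linear f /\ continuous f].

Definition bounded_operator_pred : {pred H -> H} :=
  fun f => f \in bounded_operator.

Lemma bounded_operator_submod : submod_closed bounded_operator_pred.
Proof.
split=> [|a f g /set_mem[fl fc] /set_mem[gl gc]]; apply/mem_set; split.
- by move=> a x y; rewrite /= scaler0 addr0.
- exact: cst_continuous.
- move=> b x y; rewrite !fctE fl gl !scalerDr !scalerA [b * a]mulrC.
  by rewrite addrACA.
- by move=> x; apply: cvgD; [apply: cvgZl_tmp; exact: fc|exact: gc].
Qed.

HB.instance Definition _ :=
  GRing.isSubmodClosed.Build R[i] (H -> H) bounded_operator_pred
    bounded_operator_submod.

Record bop := Bop { bop_fun :> H -> H; bopP : bop_fun \in bounded_operator_pred }.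

HB.instance Definition _ := [isSub for bop_fun].
HB.instance Definition _ := [Choice of bop by <:].
HB.instance Definition _ := [SubChoice_isSubLmodule of bop by <:].

Lemma bounded_operator_id : @id H \in bounded_operator_pred.
Proof. by apply/mem_set; split=> // x; exact: cvg_id. Qed.

Definition bop1 : bop := Bop bounded_operator_id.

Definition is_adjoint (T S : bop) : Prop :=
  forall x y : H, inner (T x) y = inner x (S y).

Definition bop_positive (T : bop) : Prop := forall x : H, 0 <= inner (T x) x.

Definition opnorm (T : bop) : R :=
  sup [set rnorm (T x) | x in [set x : H | rnorm x <= 1]].

Record sqsummable := SqSummable {
  sqs_seq :> nat -> H;
  sqsP : cvgn (series (fun n => rnorm (sqs_seq n) ^+ 2) : R^nat)
}.

HB.instance Definition _ := gen_eqMixin sqsummable.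
HB.instance Definition _ := gen_choiceMixin sqsummable.

Definition sqs_functional (T : bop) (xy : sqsummable * sqsummable) : R[i]^o :=
  limn (series (fun n => inner (T (xy.1 n)) (xy.2 n) : R[i]^o)).

(* The topology put on bop is the ultraweak one, not the norm topology: it is
   the coarsest making every T |-> \sum_n <T x_n, y_n> continuous, with x and y
   square-summable. *)
HB.instance Definition _ := Topological.copy bop
  (initial_topology
     (sqs_functional : bop -> {ptws (sqsummable * sqsummable) -> R[i]^o})).

End BoundedOperators.

Record dualOperatorSystem (R : realType) := DualOperatorSystem {
  dos_space : hilbertSpace R;
  dos_set : set (bop dos_space);
  dos_submod : submod_closed (mem dos_set);
  dos_selfadjoint :
    [set S | exists2 T, dos_set T & is_adjoint T S] = dos_set;
  dos_unit : dos_set (bop1 dos_space);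
  dos_closed : closed dos_set
}.

Arguments dos_set {R} d _.
Arguments dos_submod {R} d.
Arguments dos_unit {R} d.
Arguments dos_closed {R} d.

Section Elements.
Variables (R : realType) (M : dualOperatorSystem R).

Definition dos_pred : {pred bop (dos_space M)} := fun T => T \in dos_set M.

Lemma dos_pred_submod : submod_closed dos_pred.
Proof. exact: dos_submod. Qed.

HB.instance Definition _ :=
  GRing.isSubmodClosed.Build R[i] (bop (dos_space M)) dos_pred
    dos_pred_submod.

Record dos_elt := DosElt {
  dos_val :> bop (dos_space M);
  dos_valP : dos_val \in dos_pred
}.

HB.instance Definition _ := [isSub for dos_val].
HB.instance Definition _ := [Choice of dos_elt by <:].
HB.instance Definition _ := [SubChoice_isSubLmodule of dos_elt by <:].
HB.instance Definition _ := Topological.copy dos_elt (initial_topology dos_val).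

End Elements.

Coercion dos_elt : dualOperatorSystem >-> Sortclass.

Section ElementNotions.
Variables (R : realType) (M : dualOperatorSystem R).

Definition dos_one : M := DosElt (mem_set (dos_unit M)).

Definition dos_positive (x : M) : Prop := bop_positive x.

Definition dos_sa : set M := [set x | is_adjoint x x].

Definition sa_norm (f : M -> R[i]) : R :=
  sup [set rnorm (f x) | x in [set x | dos_sa x /\ opnorm x <= 1]].

End ElementNotions.

Record predual (R : realType) (M : dualOperatorSystem R) := Predual {
  predual_fun :> {scalar M};
  predual_normal : continuous (predual_fun : M -> R[i]^o)
}.

Record UPmap (R : realType) (M N : dualOperatorSystem R) := UPMap {
  up_fun :> {linear M -> N};
  up_normal : continuous up_fun;
  up_unital : up_fun (dos_one M) = dos_one N;
  up_positive : forall x : M, dos_positive x -> dos_positive (up_fun x)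
}.

Record UPiso (R : realType) (M N : dualOperatorSystem R) := UPIso {
  upi_map :> UPmap M N;
  upi_inv : UPmap N M;
  upi_mapK : cancel upi_map upi_inv;
  upi_invK : cancel upi_inv upi_map
}.

Record reversible_lift (R : realType) (M : dualOperatorSystem R)
    (phi : UPmap M M) := ReversibleLift {
  lift_dos : dualOperatorSystem R;
  lift_aut : UPiso lift_dos lift_dos;
  lift_map : UPmap lift_dos M;
  lift_mapE : lift_map \o lift_aut =1 phi \o lift_map
}.

Section Lifts.
Variables (R : realType) (M : dualOperatorSystem R) (phi : UPmap M M).

Definition nondegenerate_lift (L : reversible_lift phi) : Prop :=
  forall y : lift_dos L,
    (forall n, lift_map L (iter n (upi_inv (lift_aut L)) y) = 0) -> y = 0.

Definition asymptotic_lift (L : reversible_lift phi) : Prop :=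
  nondegenerate_lift L /\
  forall rho : predual M,
    (fun k => sa_norm (rho \o iter k phi)) @ \oo
      --> sa_norm (rho \o lift_map L).

End Lifts.

(* Main.v *)
Require Import Defs.
From HB Require Import structures.
From mathcomp Require Import all_boot all_order all_algebra.
From mathcomp Require Import complex.
From mathcomp Require Import all_classical all_reals all_analysis.
From mathcomp Require Import ring lra.

Set Implicit Arguments.
Unset Strict Implicit.
Unset Printing Implicit Defensive.

Import Order.TTheory GRing.Theory Num.Theory.
Import numFieldNormedType.Exports.

Local Open Scope classical_set_scope.
Local Open Scope ring_scope.
Local Open Scope complex_scope.

(** An asymptotic lift of [phi] is the inverse limit of the system
    [M <- M <- M <- ...] whose maps are all [phi]. A point of the limit is a
    bounded sequence [x] with [phi (x n.+1) = x n]. The automorphism [alpha]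
    applies [phi] to every entry, which for such a sequence prepends
    [phi (x 0)]; its inverse forgets [x 0], and [E x = x 0]. The sequence is
    recovered from the elements [E (alpha^-n x) = x n], so the lift is
    nondegenerate. To have this limit as a dual operator system, a sequence is
    realised as a block-diagonal operator on the Hilbert space of
    square-summable sequences of vectors ([ell2_hilbert], [ilim]).

    The norm formula rests on the ultraweak compactness of the unit ball of the
    self-adjoint part ([sa_ball_ultra_cvg]). The norms of [rho \o phi^k]
    decrease; if [rho (phi^k (x k))] has at least size [c] for every [k], the
    limits of [phi^(k - j) (x k)] along an ultrafilter in [k] form a point of the
    inverse limit on which [rho \o E] has at least size [c]
    ([ilim_norm_attained]). So the norm of [rho \o E] is the limit.

    For uniqueness, let [E1] and [E2] be the maps of two asymptotic lifts. The
    images of the two unit balls are compact convex symmetric sets on which every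
    normal functional has the same supremum, namely the limit in the norm
    formula; separating a point from a compact convex set by a combination of
    vector states shows that they are equal ([image_ball_subset]). So for each
    [y] in the ball of the first lift and each [n] there is a point of the
    second one whose backward orbit agrees with that of [y] up to time [n]; by
    compactness there is one which agrees forever, and it is unique by
    nondegeneracy. This defines [theta]. It is linear, unital and contractive on
    self-adjoint elements, hence positive, and its inverse comes from exchanging
    the lifts.

    What remains is that [theta] is normal. Compactness only gives continuity on
    balls, and the Krein-Smulian theorem ([ball_continuous_uw],
    [ball_continuous_normal]) turns this into ultraweak continuity. Its proof
    condenses a functional into a null sequence of vectors [zeta], dominating it
    by the supremum of [|<x zeta_j, zeta_j>|], and then extends it, in the manner
    of Hahn and Banach, to a functional on null sequences, that is, to a summable
    combination of the functionals [<x zeta_j, zeta_j>]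
    ([sup_dominated_coefficients]).

    Throughout, self-adjoint elements are measured by the order interval
    [-r <= x <= r] ([sa_ball], [dos_ball]), which positive unital maps obviously
    preserve. *)

(** * Complex numbers and the real inner product *)

Section ComplexNumbers.
Variable R : realType.

Lemma ReD (x y : R[i]) : complex.Re (x + y) = complex.Re x + complex.Re y.
Proof. by case: x; case: y. Qed.
Lemma ImD (x y : R[i]) : complex.Im (x + y) = complex.Im x + complex.Im y.
Proof. by case: x; case: y. Qed.
Lemma ReN (x : R[i]) : complex.Re (- x) = - complex.Re x.
Proof. by case: x. Qed.
Lemma ImN (x : R[i]) : complex.Im (- x) = - complex.Im x.
Proof. by case: x. Qed.
Lemma ReZ (a : R) (x : R[i]) : complex.Re (a%:C * x) = a * complex.Re x.
Proof. by case: x => u v /=; rewrite mul0r subr0. Qed.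
Lemma ImZ (a : R) (x : R[i]) : complex.Im (a%:C * x) = a * complex.Im x.
Proof. by case: x => u v /=; rewrite mul0r addr0. Qed.
Lemma ReJ (x : R[i]) : complex.Re (Num.conj x) = complex.Re x.
Proof. by case: x. Qed.
Lemma ImJ (x : R[i]) : complex.Im (Num.conj x) = - complex.Im x.
Proof. by case: x. Qed.
Lemma Re_sum (u : nat -> R[i]) m n :
  complex.Re (\sum_(m <= k < n) u k) = \sum_(m <= k < n) complex.Re (u k).
Proof. by apply: (big_morph _ ReD). Qed.
Lemma Im_sum (u : nat -> R[i]) m n :
  complex.Im (\sum_(m <= k < n) u k) = \sum_(m <= k < n) complex.Im (u k).
Proof. by apply: (big_morph _ ImD). Qed.
Lemma complexP (x y : R[i]) :
  complex.Re x = complex.Re y -> complex.Im x = complex.Im y -> x = y.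
Proof. by case: x; case: y => a b c d /= -> ->. Qed.

Lemma rnormcE (x : R[i]) :
  rnorm x = Num.sqrt (complex.Re x ^+ 2 + complex.Im x ^+ 2).
Proof. by rewrite /rnorm normc_def. Qed.

Lemma Re_le_rnorm (x : R[i]) : `|complex.Re x| <= rnorm x.
Proof. by rewrite rnormcE -sqrtr_sqr ler_wsqrtr// lerDl sqr_ge0. Qed.
Lemma Im_le_rnorm (x : R[i]) : `|complex.Im x| <= rnorm x.
Proof. by rewrite rnormcE -sqrtr_sqr ler_wsqrtr// lerDr sqr_ge0. Qed.
Lemma rnorm_le_ReIm (x : R[i]) :
  rnorm x <= `|complex.Re x| + `|complex.Im x|.
Proof.
have a0 := normr_ge0 (complex.Re x); have b0 := normr_ge0 (complex.Im x).
rewrite rnormcE -[leRHS]ger0_norm ?addr_ge0// -sqrtr_sqr ler_wsqrtr//.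
by rewrite sqrrD !real_normK ?num_real// addrAC lerDl mulrn_wge0// mulr_ge0.
Qed.

Lemma complex_scaleE (V : lmodType R[i]) (a : R[i]) (v : V) :
  a *: v = (complex.Re a)%:C *: v + (complex.Im a)%:C *: ('i *: v).
Proof. by rewrite scalerA -scalerDl mulrC -complexE. Qed.

Lemma cvg_complexP (T : Type) (F : set_system T) (FF : Filter F)
    (f : T -> R[i]^o) (l : R[i]^o) :
  f @ F --> l <-> ((fun t => complex.Re (f t)) @ F --> complex.Re l /\
                   (fun t => complex.Im (f t)) @ F --> complex.Im l).
Proof.
split=> [fl|[rel iml]].
- split; apply/cvgrPdist_lt => e e0.
  + move/cvgrPdist_lt: fl => /(_ e%:C); rewrite ltcR => /(_ e0).
    apply: filterS => t /=; rewrite normc_def ltcR; apply: le_lt_trans.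
    by rewrite -ReN -ReD -rnormcE; exact: Re_le_rnorm.
  + move/cvgrPdist_lt: fl => /(_ e%:C); rewrite ltcR => /(_ e0).
    apply: filterS => t /=; rewrite normc_def ltcR; apply: le_lt_trans.
    by rewrite -ImN -ImD -rnormcE; exact: Im_le_rnorm.
apply/cvgrPdist_lt => -[e e']; rewrite ltcE/= => /andP[/eqP -> e0].
have e20 : 0 < e / 2 by rewrite divr_gt0.
move/cvgrPdist_lt: rel => /(_ _ e20) rel.
move/cvgrPdist_lt: iml => /(_ _ e20) iml.
apply: filterS (filterI rel iml) => t /= [re_t im_t].
rewrite normc_def ltcR -rnormcE (le_lt_trans (rnorm_le_ReIm _))//.
by rewrite ReD ImD ReN ImN [e]splitr ltrD.
Qed.

End ComplexNumbers.

Lemma cvg_rnormc (R : realType) (T : Type) (F : set_system T) (FF : Filter F)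
    (f : T -> R[i]^o) (l : R[i]^o) :
  f @ F --> l -> (fun t => rnorm (f t : R[i])) @ F --> rnorm (l : R[i]).
Proof.
move=> fl; have h : (fun t => `|f t| : R[i]^o) @ F --> (`|l| : R[i]^o) by exact: cvg_norm.
by have /cvg_complexP[] := h.
Qed.

(** The Cauchy-Schwarz inequality reduced to its quadratic form; the same
    argument serves for a Hilbert space and for the sequences that are to become
    one. *)
Lemma discriminant_le (R : realType) (a b c : R) : 0 <= a -> 0 <= b ->
  (forall s t : R, 0 <= s ^+ 2 * a ^+ 2 + t ^+ 2 * b ^+ 2 - 2 * s * t * c) ->
  c <= a * b.
Proof.
move=> a0 b0 h; have [c0|c0] := leP c 0; first by rewrite (le_trans c0)// mulr_ge0.
have gt0 (u v : R) : 0 <= u -> (u = 0 -> forall s : R, 0 <= v ^+ 2 - 2 * s * c) -> 0 < u.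
  move=> u0 uv; rewrite lt_neqAle u0 andbT eq_sym; apply/eqP => /uv.
  move=> /(_ ((v ^+ 2 + 1) / (2 * c))).
  by rewrite (_ : 2 * _ * c = v ^+ 2 + 1); [lra|field; rewrite gt_eqF].
have pa : 0 < a.
  by apply: (gt0 a b) => // a00 s; have := h s 1; rewrite a00; lra.
have pb : 0 < b.
  by apply: (gt0 b a) => // b00 s; have := h 1 s; rewrite b00; lra.
have := h b a; rewrite (_ : _ - _ = (2 * (a * b)) * (a * b - c)); last by ring.
by rewrite pmulr_rge0 ?subr_ge0// mulr_gt0// mulr_gt0.
Qed.

Section HilbertBasics.
Variables (R : realType) (H : hilbertSpace R).
Implicit Types x y z : H.

(** Being real bilinear and symmetric, this part is easier to compute with, and
    it determines the inner product, since [Im <x, y> = Re <x, i y>]. *)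
Definition reip x y : R := complex.Re (inner x y).

Lemma innerC x y : inner x y = Num.conj (inner y x).
Proof. by rewrite hermC expr0 mul1r. Qed.

Lemma reipC x y : reip x y = reip y x.
Proof. by rewrite /reip innerC ReJ. Qed.
Lemma reipDl x y z : reip (x + y) z = reip x z + reip y z.
Proof. by rewrite /reip linearDl ReD. Qed.
Lemma reipDr x y z : reip z (x + y) = reip z x + reip z y.
Proof. by rewrite !(reipC z) reipDl. Qed.
Lemma reipNl x z : reip (- x) z = - reip x z.
Proof. by rewrite /reip linearNl ReN. Qed.
Lemma reipNr x z : reip z (- x) = - reip z x.
Proof. by rewrite !(reipC z) reipNl. Qed.
Lemma reip0l z : reip 0 z = 0.
Proof. by rewrite /reip linear0l. Qed.
Lemma reip0r z : reip z 0 = 0.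
Proof. by rewrite reipC reip0l. Qed.
Lemma reipZl (a : R) x z : reip (a%:C *: x) z = a * reip x z.
Proof. by rewrite /reip linearZl_LR /= ReZ. Qed.
Lemma reipZr (a : R) x z : reip z (a%:C *: x) = a * reip z x.
Proof. by rewrite !(reipC z) reipZl. Qed.
Lemma Im_inner x y : complex.Im (inner x y) = reip x ('i *: y).
Proof.
by rewrite /reip linearZr_LR /=; case: (inner x y) => a b /=; rewrite mul0r sub0r mulNr opprK mul1r.
Qed.
Lemma reip_ii x y : reip ('i *: x) ('i *: y) = reip x y.
Proof.
rewrite /reip linearZr_LR linearZl_LR /=; case: (inner x y) => a b /=; ring.
Qed.
Lemma reip_il x y : reip ('i *: x) y = - reip x ('i *: y).
Proof.
rewrite /reip linearZr_LR linearZl_LR /=; case: (inner x y) => a b /=; ring.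
Qed.
Lemma innerE x y : inner x y = reip x y +i* reip x ('i *: y).
Proof. by apply: complexP; rewrite //= Im_inner. Qed.

Lemma rnorm_ge0 x : 0 <= rnorm x.
Proof. by have := normr_ge0 x; rewrite lecE => /andP[]. Qed.
Lemma normE x : `|x| = (rnorm x)%:C.
Proof.
by have := normr_ge0 x; rewrite lecE => /andP[/eqP/= h _]; apply: complexP.
Qed.
Lemma rnorm_sqr x : rnorm x ^+ 2 = reip x x.
Proof. by rewrite /reip -hilbert_normE normE -rmorphXn. Qed.
Lemma reip_ge0 x : 0 <= reip x x. Proof. by rewrite -rnorm_sqr sqr_ge0. Qed.
Lemma inner_self x : inner x x = (rnorm x ^+ 2)%:C.
Proof. by rewrite -hilbert_normE normE rmorphXn. Qed.
Lemma reip_i_self x : reip x ('i *: x) = 0.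
Proof. by rewrite -Im_inner inner_self. Qed.

Lemma rnorm0 : rnorm (0 : H) = 0.
Proof. by rewrite /rnorm normr0. Qed.
Lemma rnorm_eq0 x : rnorm x = 0 -> x = 0.
Proof. by move=> x0; apply/eqP; rewrite -normr_eq0 normE x0. Qed.
Lemma rnormD x y : rnorm (x + y) <= rnorm x + rnorm y.
Proof. by have := ler_normD x y; rewrite !normE -rmorphD /= lecR. Qed.
Lemma rnormN x : rnorm (- x) = rnorm x.
Proof. by rewrite /rnorm normrN. Qed.
Lemma rnormZ (a : R) x : rnorm (a%:C *: x) = `|a| * rnorm x.
Proof. by rewrite /rnorm normrZ normc_def /= expr0n addr0 sqrtr_sqr ReZ. Qed.
Lemma rnorm_i x : rnorm ('i *: x) = rnorm x.
Proof.
by rewrite /rnorm normrZ normc_def/= expr0n add0r expr1n sqrtr1 ReZ mul1r.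
Qed.

Lemma rnormcZ (a : R[i]) x : rnorm (a *: x) = rnorm a * rnorm x.
Proof. by rewrite {1}/rnorm normrZ normc_def ReZ rnormcE. Qed.

Lemma CauchySchwarz x y : `|reip x y| <= rnorm x * rnorm y.
Proof.
wlog : x / 0 <= reip x y => [hw|xy0].
  case: (leP 0 (reip x y)) => [/hw //|xy0].
  by rewrite -normrN -reipNl -(rnormN x); apply: hw; rewrite reipNl oppr_ge0 ltW.
rewrite ger0_norm//.
apply: discriminant_le => [||s t]; rewrite ?rnorm_ge0//.
have := reip_ge0 (s%:C *: x - t%:C *: y).
rewrite !(reipDl, reipDr, reipNl, reipNr, reipZl, reipZr) (reipC y x) !rnorm_sqr.
lra.
Qed.

Lemma reip_ext x y : (forall z, reip x z = reip y z) -> x = y.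
Proof.
move=> h; apply/eqP; rewrite -subr_eq0; apply/eqP/rnorm_eq0/eqP.
by rewrite -sqrf_eq0 rnorm_sqr reipDl reipNl h subrr.
Qed.

Lemma parallelogram x y :
  rnorm (x + y) ^+ 2 + rnorm (x - y) ^+ 2 = 2 * (rnorm x ^+ 2 + rnorm y ^+ 2).
Proof.
by rewrite !rnorm_sqr !(reipDl, reipDr, reipNl, reipNr) (reipC y x); ring.
Qed.

Lemma rnormD_sqr_le x y :
  rnorm (x + y) ^+ 2 <= 2 * (rnorm x ^+ 2 + rnorm y ^+ 2).
Proof. by rewrite -parallelogram lerDl sqr_ge0. Qed.

Lemma cvg_rnormP (T : Type) (F : set_system T) (FF : Filter F)
    (f : T -> H) (l : H) :
  f @ F --> l <-> (fun t => rnorm (l - f t)) @ F --> (0 : R).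
Proof.
split=> [fl|fl].
  apply/cvgrPdist_lt => e e0; move/cvgrPdist_lt: fl => /(_ e%:C).
  rewrite ltcR => /(_ e0); apply: filterS => t.
  by rewrite normE ltcR sub0r normrN ger0_norm// rnorm_ge0.
apply/cvgrPdist_lt => -[e e']; rewrite ltcE/= => /andP[/eqP -> e0].
move/cvgrPdist_lt: fl => /(_ e e0); apply: filterS => t.
by rewrite normE ltcR sub0r normrN ger0_norm// rnorm_ge0.
Qed.

Lemma cvg_rnorm (T : Type) (F : set_system T) (FF : Filter F)
    (f : T -> H) (l : H) :
  f @ F --> l -> (fun t => rnorm (f t)) @ F --> rnorm l.
Proof.
move=> fl; have h : (fun t => `|f t| : R[i]^o) @ F --> (`|l| : R[i]^o) by exact: cvg_norm.
by have /cvg_complexP[] := h.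
Qed.

End HilbertBasics.

(** * Real series, ultrafilters and initial topologies *)

Section RealSeries.
Variable R : realType.
Implicit Types u v : nat -> R.

Lemma dominated_series_cvg u v :
  (forall n, `|u n| <= v n) -> cvgn (series v) -> cvgn (series u).
Proof.
move=> uv vc; apply: (@normed_cvg R R^o).
apply: series_le_cvg vc => n //=.
exact: le_trans (normr_ge0 _) (uv n).
Qed.

Lemma dominated_series_tail u v N :
  (forall n, `|u n| <= v n) -> cvgn (series v) ->
  `|limn (series u) - series u N| <= limn (series v) - series v N.
Proof.
move=> uv vc; have uc := dominated_series_cvg uv vc.
have cu : (fun n => `|series u n - series u N|) @ \oo -->
    `|limn (series u) - series u N|.
  by apply: cvg_norm; apply: cvgB => //; exact: cvg_cst.
have cv : (fun n => series v n - series v N) @ \oo -->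
    limn (series v) - series v N.
  by apply: cvgB => //; exact: cvg_cst.
apply: ler_cvg_to cu cv _; exists N => // n /= Nn.
rewrite !sub_series_geq// (le_trans (ler_norm_sum _ _ _))//.
by apply: ler_sum => i _.
Qed.

Lemma dominated_series_le u v :
  (forall n, `|u n| <= v n) -> cvgn (series v) ->
  `|limn (series u)| <= limn (series v).
Proof.
move=> uv vc; have := dominated_series_tail 0 uv vc.
by rewrite /series /= !big_geq// !subr0.
Qed.

Lemma series_ge0 u : (forall n, 0 <= u n) -> cvgn (series u) ->
  0 <= limn (series u).
Proof.
move=> u0 uc; apply: limr_ge => //; apply: nearW => n.
by rewrite sumr_ge0.
Qed.

Lemma series_partial_le u N : (forall n, 0 <= u n) -> cvgn (series u) ->
  series u N <= limn (series u).
Proof.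
move=> u0 uc; apply: limr_ge => //; exists N => // n /= Nn.
by rewrite -subr_ge0 sub_series_geq// sumr_ge0.
Qed.

Lemma series_tail_small u (e : R) : cvgn (series u) -> 0 < e ->
  exists N, `|limn (series u) - series u N| < e.
Proof.
by move=> /cvgrPdist_lt h e0; have [N _ /(_ N) hN] := h _ e0; exists N; apply: hN => /=.
Qed.

Lemma bounded_series_cvg u (M : R) : (forall n, 0 <= u n) ->
  (forall n, series u n <= M) -> cvgn (series u).
Proof.
move=> u0 uM; apply: nondecreasing_is_cvgn; first exact: nondecreasing_series.
by exists M => _ [n _ <-].
Qed.

Lemma series_eventually_constant u N :
  (forall n, (N <= n)%N -> u n = 0) -> series u @ \oo --> series u N.
Proof.
move=> u0; apply/cvgrPdist_lt => e e0; exists N => // n /= Nn.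
rewrite -normrN opprB sub_series_geq// big_nat big1 ?normr0// => i /andP[Ni _].
exact: u0.
Qed.

(** Dominated convergence for series along any filter: one tail of the
    dominating series bounds the tails of all the others. *)
Lemma dominated_series_limit (T : Type) (F : set_system T) (FF : Filter F)
    (f : T -> nat -> R) (g v : nat -> R) :
  (\forall t \near F, forall n, `|f t n| <= v n) ->
  (forall n, `|g n| <= v n) -> cvgn (series v) ->
  (forall n, (fun t => f t n) @ F --> g n) ->
  (fun t => limn (series (f t))) @ F --> limn (series g).
Proof.
move=> fv gv vc fg; apply/cvgrPdist_lt => e e0.
have e30 : 0 < e / 3 by rewrite divr_gt0.
have [N] := series_tail_small vc e30.
rewrite ltr_norml => /andP[_ tailN].
have cN : (fun t => series (f t) N) @ F --> series g N.
  rewrite /series /=.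
  elim: N {tailN} => [|N IH].
    by rewrite big_geq//; under eq_fun do rewrite big_geq//; exact: cvg_cst.
  rewrite big_nat_recr//=; under eq_fun do rewrite big_nat_recr//=.
  by apply: cvgD; [exact: IH|exact: fg].
move/cvgrPdist_lt: cN => /(_ _ e30) cN.
apply: filterS (filterI fv cN) => t [ft gt].
have h1 := dominated_series_tail N gv vc.
have h2 := dominated_series_tail N ft vc.
rewrite (_ : _ - _ = (limn (series g) - series g N) +
   (series g N - series (f t) N) - (limn (series (f t)) - series (f t) N));
  last by ring.
apply: le_lt_trans (ler_normB _ _) _.
apply: (@le_lt_trans _ _ (`|limn (series g) - series g N| + `|series g N - series (f t) N| +
  `|limn (series (f t)) - series (f t) N|)).
  by rewrite lerD2r ler_normD.
lra.
Qed.

End RealSeries.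

Section Ultrafilters.

Lemma ultra_fmap (T U : Type) (f : T -> U) (F : set_system T) :
  UltraFilter F -> UltraFilter (f @ F).
Proof.
move=> FU; split; first exact: fmap_proper_filter.
move=> G GF sFG; rewrite predeqE => A; split; last exact: sFG.
move=> GA; have [//|FnA] := in_ultra_setVsetC (f @^-1` A) FU.
have GnA : G (~` A) by apply: sFG.
by have /filter_ex [? []] : G (A `&` ~` A) by exact: filterI.
Qed.

Lemma ultra_bounded_cvg (R : realType) (T : Type) (F : set_system T)
    (f : T -> R) (C : R) : UltraFilter F ->
  (\forall t \near F, `|f t| <= C) ->
  exists2 l, `|l| <= C & f @ F --> l.
Proof.
move=> FU fC; have := @segment_compact R (- C) C; rewrite compact_ultra.
move=> /(_ _ (ultra_fmap f FU)); case.
  by apply: filterS fC => t; rewrite ler_norml /= in_itv.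
by move=> l [/= ]; rewrite in_itv/= -ler_norml => lC fl; exists l.
Qed.

End Ultrafilters.

Section ContinuousReal.
Variables (R : realType).

Lemma cvg_initial (S : choiceType) (T : topologicalType) (f : S -> T)
    (F : set_system S) (s : S) : Filter F ->
  F --> (s : initial_topology f) <-> f @ F --> f s.
Proof.
move=> FF; split=> [Fs|fFs].
  by move=> A /(@initial_continuous _ _ f s); exact: Fs.
move=> A /= [_ [[B Bop <-] Bfs sBfA]].
apply: filterS sBfA _; apply: fFs; exact: open_nbhs_nbhs.
Qed.

(** The product topology is the supremum of the topologies pulled back by the
    coordinates, whatever the index type. *)
Lemma cvg_ptwsP (I : Type) (T : topologicalType)
    (F : set_system {ptws I -> T}) (f : {ptws I -> T}) : Filter F ->
  F --> f <-> forall i, (fun g : {ptws I -> T} => g i) @ F --> f i.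
Proof.
move=> FF; rewrite (@cvg_sup _ _ _ F f FF); split=> h i.
  by have /cvg_initial := h i; apply.
by apply/cvg_initial; exact: h.
Qed.

End ContinuousReal.

(** * Riesz representation and bounded operators *)

Section Riesz.
Variables (R : realType) (H : hilbertSpace R).
Implicit Types x y z : H.

Lemma hilbert_complete (y : nat -> H) (d : nat -> R) :
  d @ \oo --> (0 : R) ->
  (forall n m, rnorm (y n - y m) <= d n + d m) ->
  exists z, (fun n => rnorm (z - y n)) @ \oo --> (0 : R).
Proof.
move=> d0 yd; suff /cvg_ex[z yz] : cvg (y @ \oo).
  by exists z; apply/cvg_rnormP.
apply/cauchy_cvgP/cauchy_ballP => -[e e']; rewrite ltcE/= => /andP[/eqP -> e0].
have e20 : 0 < e / 2 by rewrite divr_gt0.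
move/cvgrPdist_lt: d0 => /(_ _ e20)[N _ dN].
pose A : set H := y @` [set n | (N <= n)%N].
have yA : (y @ \oo) A by exists N => // n Nn /=; exists n.
exists (A, A) => //= -[_ _] [[n /dN/= nd <-] [m /dN/= md <-]].
rewrite -ball_normE /ball_ /= normE ltcR.
apply: le_lt_trans (yd n m) _; move: nd md; rewrite !sub0r !normrN => nd md.
by rewrite [e]splitr ltrD// (le_lt_trans (ler_norm _)).
Qed.

(** The Riesz representation of a bounded real-linear functional [l], by
    minimising [|y|^2 - 2 l(y)]: an almost minimiser [y] satisfies
    [|<y, h> - l(h)| <= e |h|] for every [h], and such [y] form a Cauchy family
    as [e] decreases. *)
Lemma riesz (l : H -> R) (C : R) :
  {morph l : x y / x + y} -> (forall (a : R) x, l (a%:C *: x) = a * l x) ->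
  (forall x, `|l x| <= C * rnorm x) ->
  exists z, forall x, l x = reip z x.
Proof.
move=> lD lZ lC.
pose J y := rnorm y ^+ 2 - 2 * l y.
have J_ge y : - C ^+ 2 <= J y.
  have := lC y; rewrite ler_norml => /andP[_ ly].
  have := sqr_ge0 (rnorm y - C); rewrite /J; lra.
pose m := inf (range J).
have Jm y : m <= J y.
  apply: ge_inf; last by exists y.
  by exists (- C ^+ 2) => _ [z _ <-].
have l0 : l 0 = 0 by rewrite -[X in l X](scale0r (0 : H)) (lZ 0) mul0r.
have near_min (e : R) : 0 < e ->
    exists y, forall h, `|reip y h - l h| <= e * rnorm h.
  move=> e0; have e20 : 0 < e ^+ 2 by rewrite exprn_gt0.
  have : has_inf (range J).
    split; first by exists (J 0), 0.
    by exists (- C ^+ 2) => _ [z _ <-].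
  move=> /(inf_adherent e20)[_ [y _ <-]] Jy; exists y => h.
  set q := reip y h - l h.
  have key (t : R) : 0 <= e ^+ 2 + 2 * t * q + t ^+ 2 * rnorm h ^+ 2.
    have := Jm (y + t%:C *: h); rewrite /J lD lZ rnorm_sqr.
    rewrite !(reipDl, reipDr, reipZl, reipZr) (reipC h y) -!rnorm_sqr.
    move: Jy; rewrite -/m /J /q; lra.
  have [h0|h0] := eqVneq (rnorm h) 0.
    by rewrite h0 mulr0 /q (rnorm_eq0 h0) reip0r l0 subrr normr0.
  have ph : 0 < rnorm h ^+ 2 by rewrite exprn_gt0// lt_neqAle eq_sym h0 rnorm_ge0.
  have := key (- q / rnorm h ^+ 2).
  have -> : e ^+ 2 + 2 * (- q / rnorm h ^+ 2) * q +
     (- q / rnorm h ^+ 2) ^+ 2 * rnorm h ^+ 2 = e ^+ 2 - q ^+ 2 / rnorm h ^+ 2.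
    by field.
  rewrite subr_ge0 ler_pdivrMr// -exprMn => qe.
  by rewrite -[leRHS]ger0_norm ?mulr_ge0 ?rnorm_ge0 ?(ltW e0)// -!sqrtr_sqr ler_wsqrtr.
pose d n : R := n.+1%:R^-1.
have d_gt0 n : 0 < d n by rewrite invr_gt0.
have [y yP] := choice (fun n => near_min _ (d_gt0 n)).
have d0 : d @ \oo --> (0 : R) by exact: cvg_harmonic.
have [n k|z yz] := hilbert_complete (y := y) d0.
  set h := y n - y k.
  have [h0|h0] := eqVneq (rnorm h) 0; first by rewrite h0 addr_ge0// ltW.
  have ph : 0 < rnorm h by rewrite lt_neqAle eq_sym h0 rnorm_ge0.
  rewrite -(ler_pM2r ph) -expr2 rnorm_sqr {1}/h reipDl reipNl mulrDl.
  have := yP n h; have := yP k h; rewrite !ler_norml => /andP[? ?] /andP[? ?]; lra.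
exists z => h; apply/eqP; rewrite eq_sym -subr_eq0 -normr_le0.
have lim0 : (fun n => (d n + rnorm (z - y n)) * rnorm h) @ \oo --> (0 : R).
  rewrite (_ : 0 = (0 + 0) * rnorm h); last by rewrite addr0 mul0r.
  by apply: cvgM; [exact: cvgD|exact: cvg_cst].
rewrite -(cvg_lim (@Rhausdorff R) lim0); apply: limr_ge.
  by apply/cvg_ex; exists 0.
apply: nearW => n.
have := CauchySchwarz (z - y n) h; have := yP n h.
rewrite reipDl reipNl mulrDl.
rewrite (_ : reip z h - l h = (reip (y n) h - l h) + (reip z h - reip (y n) h));
  last by ring.
by move=> h1 h2; rewrite (le_trans (ler_normD _ _))// lerD.
Qed.

End Riesz.

Section Operators.
Variables (R : realType) (H : hilbertSpace R).
Implicit Types (x y z : H) (S T : bop H).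

Lemma bop_linear T : linear T.
Proof. by have /set_mem[] := bopP T. Qed.
Lemma bop_D T x y : T (x + y) = T x + T y.
Proof. by have := bop_linear T 1 x y; rewrite !scale1r. Qed.
Lemma bop_0 T : T 0 = 0.
Proof.
have := bop_D T 0 0; rewrite addr0 => /eqP.
by rewrite -subr_eq0 opprD addNKr oppr_eq0 => /eqP.
Qed.
Lemma bop_Z T (a : R[i]) x : T (a *: x) = a *: T x.
Proof. by have := bop_linear T a x 0; rewrite !addr0 bop_0 addr0. Qed.
Lemma bop_N T x : T (- x) = - T x.
Proof. by rewrite -scaleN1r bop_Z scaleN1r. Qed.
Lemma bop_B T x y : T (x - y) = T x - T y.
Proof. by rewrite bop_D bop_N. Qed.

Lemma bop_addE S T x : (S + T) x = S x + T x.
Proof. by []. Qed.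
Lemma bop_oppE S x : (- S) x = - S x.
Proof. by []. Qed.
Lemma bop_scaleE (a : R[i]) S x : (a *: S) x = a *: S x.
Proof. by []. Qed.
Lemma bop_eqP S T : (forall x, S x = T x) -> S = T.
Proof. by move=> h; apply/val_inj/funext. Qed.

Lemma bop_reip_ext S T : (forall x y, reip (S x) y = reip (T x) y) -> S = T.
Proof. by move=> h; apply: bop_eqP => x; apply: reip_ext => y. Qed.

Lemma bop_bounded T : exists2 C : R, 0 <= C & forall x, rnorm (T x) <= C * rnorm x.
Proof.
have /set_mem[_ Tc] := bopP T.
have /cvg_rnormP/cvgrPdist_lt/(_ 1 ltr01) := Tc 0; rewrite /= bop_0.
move=> /nbhs_ballP[[e e']] /=; rewrite ltcE /= => /andP[/eqP -> e0] eT.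
have eT' x : rnorm x < e -> rnorm (T x) < 1.
  move=> xe; have := eT x; rewrite -ball_normE /ball_/= sub0r normrN normE ltcR.
  by move=> /(_ xe); rewrite !sub0r normrN rnormN ger0_norm// rnorm_ge0.
exists (2 / e) => [|x]; first by rewrite divr_ge0// ltW.
have [x0|x0] := eqVneq (rnorm x) 0.
  by rewrite (rnorm_eq0 x0) bop_0 rnorm0 mulr0.
have px : 0 < rnorm x by rewrite lt_neqAle eq_sym x0 rnorm_ge0.
have c0 : 0 < e / (2 * rnorm x) by rewrite divr_gt0// mulr_gt0.
have := eT' ((e / (2 * rnorm x))%:C *: x).
rewrite bop_Z !rnormZ ger0_norm ?(ltW c0)//.
have -> : e / (2 * rnorm x) * rnorm x = e / 2 by field.
move=> /(_ (ltac:(lra))); rewrite mulrC -ltr_pdivlMr// => /ltW.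
by congr (_ <= _); field; rewrite x0 gt_eqF.
Qed.

Lemma bounded_operator_mem (f : H -> H) (C : R) : linear f ->
  (forall x, rnorm (f x) <= C * rnorm x) -> f \in @bounded_operator_pred R H.
Proof.
move=> fl fC; apply/mem_set; split=> // x; apply/cvg_rnormP.
have fB u v : f u - f v = f (u - v).
  by have := fl (-1) v u; rewrite !scaleN1r addrC => <-; rewrite addrC.
have xx : (fun t => rnorm (x - t)) @ nbhs x --> (0 : R).
  by apply/cvg_rnormP; exact: cvg_id.
have C0 : (fun t => C * rnorm (x - t)) @ nbhs x --> (0 : R).
  by rewrite -[X in _ --> X](mulr0 C); apply: cvgM => //; exact: cvg_cst.
apply: squeeze_cvgr (@cvg_cst _ (0 : R) _ _ _) C0; apply: nearW => t.
by rewrite rnorm_ge0 fB fC.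
Qed.

Definition mkbop (f : H -> H) (C : R) (fl : linear f)
  (fC : forall x, rnorm (f x) <= C * rnorm x) : bop H :=
  Bop (bounded_operator_mem fl fC).

Lemma is_adjointP S T :
  is_adjoint S T <-> forall x y, reip (S x) y = reip x (T y).
Proof.
split=> h x y; first by rewrite /reip h.
by rewrite !innerE !h bop_Z.
Qed.

Lemma is_adjoint_sym S T : is_adjoint S T -> is_adjoint T S.
Proof. by move=> /is_adjointP h; apply/is_adjointP => x y; rewrite reipC -h reipC. Qed.

Lemma adjoint_unique T S S' :
  is_adjoint T S -> is_adjoint T S' -> S = S'.
Proof.
move=> /is_adjointP h /is_adjointP h'; apply: bop_reip_ext => a b.
by rewrite reipC -h h' reipC.
Qed.

Lemma adjoint_rnorm_le T S (C : R) :
  is_adjoint T S -> (forall a, rnorm (T a) <= C * rnorm a) ->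
  forall a, rnorm (S a) <= C * rnorm a.
Proof.
move=> /is_adjointP TS TC a; have [s0|s0] := eqVneq (rnorm (S a)) 0.
  by rewrite s0; exact: le_trans (rnorm_ge0 _) (TC a).
have ps : 0 < rnorm (S a) by rewrite lt_neqAle eq_sym s0 rnorm_ge0.
rewrite -(ler_pM2l ps) -expr2 rnorm_sqr -TS (le_trans (ler_norm _))//.
by rewrite (le_trans (CauchySchwarz _ _))// mulrCA mulrA ler_wpM2r ?rnorm_ge0.
Qed.

Lemma bop_positiveP T : bop_positive T <->
  forall x, 0 <= reip (T x) x /\ reip (T x) ('i *: x) = 0.
Proof.
split=> h x; first by have := h x; rewrite innerE lecE /= => /andP[/eqP -> ->].
by have [h1 h2] := h x; rewrite innerE h2 lecE /= eqxx.
Qed.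

Lemma sa_reip_i T x : is_adjoint T T -> reip (T x) ('i *: x) = 0.
Proof.
move=> /is_adjointP h; have := h x ('i *: x).
by rewrite bop_Z -[RHS]opprK -reip_il (reipC ('i *: x)); lra.
Qed.

(** Polarization: the hypothesis is used at [x + i y]. *)
Lemma real_quadratic_sa T :
  (forall x, reip (T x) ('i *: x) = 0) -> is_adjoint T T.
Proof.
move=> h; apply/is_adjointP => x y.
have := h (x + 'i *: y); rewrite bop_D bop_Z scalerDr !reipDl !reipDr !h.
rewrite !reip_ii h scalerA -expr2 sqr_i scaleN1r reipNr (reipC (T y)); lra.
Qed.

Lemma positive_sa T : bop_positive T -> is_adjoint T T.
Proof. by move=> /bop_positiveP h; apply: real_quadratic_sa => x; case: (h x). Qed.

Lemma sa_D S T : is_adjoint S S -> is_adjoint T T -> is_adjoint (S + T) (S + T).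
Proof.
move=> /is_adjointP s /is_adjointP t; apply/is_adjointP => x y.
by rewrite !bop_addE reipDl reipDr s t.
Qed.
Lemma sa_Z (a : R) T : is_adjoint T T -> is_adjoint (a%:C *: T) (a%:C *: T).
Proof.
move=> /is_adjointP t; apply/is_adjointP => x y.
by rewrite !bop_scaleE reipZl reipZr t.
Qed.
Lemma sa_N T : is_adjoint T T -> is_adjoint (- T) (- T).
Proof.
move=> /is_adjointP t; apply/is_adjointP => x y.
by rewrite !bop_oppE reipNl reipNr t.
Qed.

(** A ball defined by the numerical radius: it is the order interval from [- r]
    to [r] ([sa_ballP]) and also the ball of the operator norm ([sa_ball_rnorm],
    [sa_ball1E]). *)
Definition sa_ball (r : R) : set (bop H) := [set T | is_adjoint T T /\
  forall x, `|reip (T x) x| <= r * rnorm x ^+ 2].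

(** Polarization and the parallelogram law bound [<T x, y>] by
    [r (|x|^2 + |y|^2) / 2]; this is applied to the multiple [y] of [T x] that
    has the length of [x]. *)
Lemma sa_ball_rnorm r T x : sa_ball r T -> rnorm (T x) <= r * rnorm x.
Proof.
move=> [Tsa Tr].
have [b0|b0] := eqVneq (rnorm (T x)) 0.
  rewrite b0; have [->|x0] := eqVneq (rnorm x) 0; first by rewrite mulr0.
  have px : 0 < rnorm x by rewrite lt_neqAle eq_sym x0 rnorm_ge0.
  have := le_trans (normr_ge0 _) (Tr x).
  by rewrite pmulr_lge0 ?exprn_gt0// => r0; rewrite mulr_ge0// ltW.
have pb : 0 < rnorm (T x) by rewrite lt_neqAle eq_sym b0 rnorm_ge0.
have [a0|a0] := eqVneq (rnorm x) 0.
  by move: b0; rewrite (rnorm_eq0 a0) bop_0 rnorm0 eqxx.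
have pa : 0 < rnorm x by rewrite lt_neqAle eq_sym a0 rnorm_ge0.
pose s := rnorm x / rnorm (T x).
pose y := s%:C *: T x.
have key : 4 * reip (T x) y <= r * (2 * (rnorm x ^+ 2 + rnorm y ^+ 2)).
  have -> : 4 * reip (T x) y =
      reip (T (x + y)) (x + y) - reip (T (x - y)) (x - y).
    rewrite bop_D bop_B !(reipDl, reipDr, reipNl, reipNr).
    have /is_adjointP h := Tsa; rewrite (h y x) (reipC y (T x)); lra.
  rewrite -parallelogram mulrDr.
  have := Tr (x + y); have := Tr (x - y); rewrite !ler_norml => /andP[? ?] /andP[? ?]; lra.
move: key; rewrite /y reipZr rnormZ -rnorm_sqr ger0_norm ?divr_ge0 ?rnorm_ge0//.
have -> : s * rnorm (T x) = rnorm x by rewrite /s; field.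
have -> : s * rnorm (T x) ^+ 2 = rnorm x * rnorm (T x) by rewrite /s; field.
move=> h; rewrite -(ler_pM2l pa); lra.
Qed.

Lemma sa_ballP r T : sa_ball r T <->
  bop_positive (r%:C *: bop1 H - T) /\ bop_positive (r%:C *: bop1 H + T).
Proof.
have E1 x : reip ((r%:C *: bop1 H - T) x) x = r * rnorm x ^+ 2 - reip (T x) x.
  by rewrite bop_addE bop_oppE bop_scaleE reipDl reipNl reipZl rnorm_sqr.
have E2 x : reip ((r%:C *: bop1 H + T) x) x = r * rnorm x ^+ 2 + reip (T x) x.
  by rewrite bop_addE bop_scaleE reipDl reipZl rnorm_sqr.
split=> [[Tsa Tr]|[p1 p2]].
  have I x : reip ((r%:C *: bop1 H) x) ('i *: x) = 0.
    by rewrite bop_scaleE reipZl reip_i_self mulr0.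
  split; apply/bop_positiveP => x; have := Tr x; rewrite ler_norml => /andP[? ?].
    by rewrite E1 bop_addE bop_oppE reipDl reipNl I sa_reip_i//; split; lra.
  by rewrite E2 bop_addE reipDl I sa_reip_i//; split; lra.
split.
  have -> : T = (2^-1)%:C *: ((r%:C *: bop1 H + T) + (- (r%:C *: bop1 H - T))).
    rewrite opprD opprK addrACA subrr add0r scalerDr -scalerDl -rmorphD /=.
    by rewrite -[X in X%:C](_ : 1 = _) ?rmorph1 ?scale1r//; field.
  by apply/sa_Z/sa_D; [exact: positive_sa|apply: sa_N; exact: positive_sa].
move=> x; move/bop_positiveP: p1 => /(_ x)[]; rewrite E1 => h1 _.
by move/bop_positiveP: p2 => /(_ x)[]; rewrite E2 => h2 _; rewrite ler_norml; lra.
Qed.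

Lemma opnorm_le1P T : opnorm T <= 1 <-> forall x, rnorm (T x) <= rnorm x.
Proof.
split=> [h x|h].
  have [x0|x0] := eqVneq (rnorm x) 0.
    by rewrite (rnorm_eq0 x0) bop_0.
  have px : 0 < rnorm x by rewrite lt_neqAle eq_sym x0 rnorm_ge0.
  have [C C0 TC] := bop_bounded T.
  have : rnorm (T ((rnorm x)^-1%:C *: x)) <= 1.
    apply: le_trans h; apply: ub_le_sup.
      exists C => _ [z /= z1 <-]; apply: le_trans (TC z) _.
      by rewrite ler_piMr.
    exists ((rnorm x)^-1%:C *: x) => //=.
    by rewrite rnormZ ger0_norm ?invr_ge0 ?rnorm_ge0// mulVf.
  by rewrite bop_Z rnormZ ger0_norm ?invr_ge0 ?rnorm_ge0// ler_pdivrMl// mulr1.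
apply: ge_sup; first by exists (rnorm (T 0)), 0 => //=; rewrite rnorm0.
by move=> _ [z /= z1 <-]; exact: le_trans (h z) z1.
Qed.

Lemma sa_ball1E T : (is_adjoint T T /\ opnorm T <= 1) <-> sa_ball 1 T.
Proof.
split=> [[Tsa /opnorm_le1P T1]|h].
  split=> // x; apply: le_trans (CauchySchwarz _ _) _.
  by rewrite mul1r expr2 ler_wpM2r ?rnorm_ge0.
split; first by case: h.
by apply/opnorm_le1P => x; rewrite -[leRHS]mul1r; exact: sa_ball_rnorm.
Qed.

Lemma sa_in_ball T : is_adjoint T T -> exists2 r, 0 <= r & sa_ball r T.
Proof.
move=> Tsa; have [C C0 TC] := bop_bounded T; exists C => //; split=> // x.
apply: le_trans (CauchySchwarz _ _) _.
by rewrite expr2 mulrA ler_wpM2r ?rnorm_ge0.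
Qed.

End Operators.

(** * The ultraweak topology and compactness of balls *)

Section SquareSummable.
Variables (R : realType) (H K : hilbertSpace R).

Lemma sqs_map_subproof (f : H -> K) (C : R)
  (fC : forall z, rnorm (f z) <= C * rnorm z) (x : sqsummable H) :
  cvgn (series (fun n => rnorm (f (x n)) ^+ 2) : R^nat).
Proof.
apply: (@dominated_series_cvg _ _ (C ^+ 2 *: (fun n => rnorm (x n) ^+ 2))).
  move=> n; rewrite ger0_norm ?sqr_ge0// fctE /GRing.scale/= -exprMn.
  by rewrite ler_sqr ?nnegrE ?rnorm_ge0// (le_trans (rnorm_ge0 _) (fC _)).
by apply: is_cvg_seriesZ; exact: (@sqsP _ _ x).
Qed.

Definition sqs_map (f : H -> K) (C : R)
  (fC : forall z, rnorm (f z) <= C * rnorm z) (x : sqsummable H) :=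
  SqSummable (@sqs_map_subproof f C fC x).

Lemma sqs_single_subproof (z : H) :
  cvgn (series (fun n => rnorm (if n == 0 then z else 0) ^+ 2) : R^nat).
Proof.
apply/cvg_ex; eexists; apply: (@series_eventually_constant _ _ 1).
by case=> // n _; rewrite /= rnorm0 expr0n.
Qed.

Definition sqs_single (z : H) := SqSummable (@sqs_single_subproof z).

End SquareSummable.

Section Ultraweak.
Variables (R : realType) (H : hilbertSpace R).
Implicit Types (x y : sqsummable H) (S T : bop H).

Lemma sqs_prod_cvg x y :
  cvgn (series (fun n => rnorm (x n) * rnorm (y n)) : R^nat).
Proof.
apply: (@dominated_series_cvg _ _
  ((fun n => rnorm (x n) ^+ 2) + (fun n => rnorm (y n) ^+ 2))).
  move=> n; rewrite ger0_norm ?mulr_ge0 ?rnorm_ge0// fctE.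
  have := sqr_ge0 (rnorm (x n) - rnorm (y n)).
  have : 0 <= rnorm (x n) * rnorm (y n) by rewrite mulr_ge0 ?rnorm_ge0.
  by lra.
by apply: is_cvg_seriesD; exact: (@sqsP _ _ _).
Qed.

Definition sqs_i x : sqsummable H :=
  sqs_map (f := fun z => 'i *: z) (C := 1)
    (fun z => ltac:(by rewrite rnorm_i mul1r)) x.

(** The real parts of the functionals that define the ultraweak topology; the
    imaginary parts are obtained by replacing [y] with [sqs_i y]. *)
Definition uw T x y : R := limn (series (fun n => reip (T (x n)) (y n))).

Lemma uw_term_le T (C : R) x y n : (forall z, rnorm (T z) <= C * rnorm z) ->
  `|reip (T (x n)) (y n)| <= C * (rnorm (x n) * rnorm (y n)).
Proof.
move=> TC; apply: le_trans (CauchySchwarz _ _) _.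
by rewrite mulrA ler_wpM2r ?rnorm_ge0.
Qed.

Lemma uw_dominant_cvg (C : R) x y :
  cvgn (series (fun n => C * (rnorm (x n) * rnorm (y n))) : R^nat).
Proof.
apply: (@is_cvg_seriesZ _ (fun n => rnorm (x n) * rnorm (y n)) C).
exact: (@sqs_prod_cvg x y).
Qed.

Lemma uw_cvg T x y : cvgn (series (fun n => reip (T (x n)) (y n)) : R^nat).
Proof.
have [C _ TC] := bop_bounded T.
apply: (dominated_series_cvg _ (@uw_dominant_cvg C x y)) => n.
exact: uw_term_le.
Qed.

Lemma sqs_functional_ReIm T x y :
  complex.Re (sqs_functional T (x, y)) = uw T x y /\
  complex.Im (sqs_functional T (x, y)) = uw T x (sqs_i y).
Proof.
have : series (fun n => inner (T (x n)) (y n) : R[i]^o) @ \oo -->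
    (uw T x y +i* uw T x (sqs_i y) : R[i]^o).
  apply/cvg_complexP; rewrite /series /=; split.
    by under eq_fun do rewrite Re_sum; exact: uw_cvg.
  under eq_fun do rewrite Im_sum; under eq_fun do under eq_bigr do rewrite Im_inner.
  exact: (@uw_cvg T x (sqs_i y)).
by move=> /cvg_lim h; rewrite /sqs_functional /= h//; exact: norm_hausdorff.
Qed.

Lemma uwD S T x y : uw (S + T) x y = uw S x y + uw T x y.
Proof.
rewrite /uw -lim_seriesD; [|exact: uw_cvg|exact: uw_cvg].
by congr (limn (series _)); apply/funext => n; rewrite bop_addE reipDl.
Qed.

Lemma uwZ (a : R) T x y : uw (a%:C *: T) x y = a * uw T x y.
Proof.
rewrite /uw -[RHS]/(a *: limn (series (fun n => reip (T (x n)) (y n)))).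
rewrite -lim_seriesZ; last exact: uw_cvg.
by congr (limn (series _)); apply/funext => n; rewrite bop_scaleE reipZl.
Qed.

Lemma uwN T x y : uw (- T) x y = - uw T x y.
Proof.
rewrite /uw -lim_seriesN; last exact: uw_cvg.
by congr (limn (series _)); apply/funext => n; rewrite bop_oppE reipNl.
Qed.

Lemma uw_i T x y : uw ('i *: T) x y = - uw T x (sqs_i y).
Proof.
rewrite /uw -lim_seriesN; last exact: (@uw_cvg T x (sqs_i y)).
by congr (limn (series _)); apply/funext => n; rewrite bop_scaleE reip_il.
Qed.

Lemma uw_single T (a b : H) :
  uw T (sqs_single a) (sqs_single b) = reip (T a) b.
Proof.
apply: (cvg_lim (@Rhausdorff R)).
have -> : reip (T a) b =
    series (fun n => reip (T (sqs_single a n)) (sqs_single b n)) 1.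
  by rewrite /series /= big_nat1.
by apply: series_eventually_constant; case=> // n _ /=; rewrite reip0r.
Qed.

Lemma bop_cvgP (F : set_system (bop H)) T : Filter F ->
  F --> T <-> forall x y, (fun S => uw S x y) @ F --> uw T x y.
Proof.
move=> FF.
have -> : F --> T <-> forall xy : sqsummable H * sqsummable H,
    (fun S => sqs_functional S xy) @ F --> sqs_functional T xy.
  have E := @cvg_initial (bop H) {ptws (sqsummable H * sqsummable H) -> R[i]^o}
    (@sqs_functional R H) F T FF.
  split=> [/(proj1 E)/cvg_ptwsP h xy|h]; first exact: h.
  by apply/(proj2 E)/cvg_ptwsP => xy; exact: h.
split=> [h x y|h [x y]].
  have /cvg_complexP[+ _] := h (x, y).
  by under eq_fun do rewrite (sqs_functional_ReIm _ x y).1; rewrite (sqs_functional_ReIm _ x y).1.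
apply/cvg_complexP; rewrite (sqs_functional_ReIm _ x y).1 (sqs_functional_ReIm _ x y).2.
split.
  by under eq_fun do rewrite (sqs_functional_ReIm _ x y).1; exact: h.
by under eq_fun do rewrite (sqs_functional_ReIm _ x y).2; exact: h.
Qed.

Lemma bop_cvg_reip (F : set_system (bop H)) T (a b : H) : Filter F ->
  F --> T -> (fun S : bop H => reip (S a) b) @ F --> reip (T a) b.
Proof.
move=> FF /bop_cvgP/(_ (sqs_single a) (sqs_single b)).
by rewrite uw_single; under eq_fun do rewrite uw_single.
Qed.

Lemma bop_cvg_unique (F : set_system (bop H)) S T : ProperFilter F ->
  F --> S -> F --> T -> S = T.
Proof.
move=> FF FS FT; apply: bop_reip_ext => a b.
by rewrite -(cvg_lim (@Rhausdorff R) (@bop_cvg_reip F S a b FF FS))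
  -(cvg_lim (@Rhausdorff R) (@bop_cvg_reip F T a b FF FT)).
Qed.

End Ultraweak.

Section BanachAlaoglu.
Variables (R : realType) (H : hilbertSpace R).
Implicit Types S T : bop H.

(** Banach-Alaoglu for self-adjoint operators: the matrix coefficients of an
    ultrafilter in the ball converge, their limits are those of an operator by
    Riesz representation, and on the ball the convergence of the coefficients is
    ultraweak convergence by dominated convergence. *)
Lemma sa_ball_ultra_cvg (r : R) (F : set_system (bop H)) : UltraFilter F ->
  0 <= r -> F (sa_ball r) -> exists2 T, sa_ball r T & F --> T.
Proof.
move=> FU r0 Fr.
have bnd (x y : H) : \forall S \near F, `|reip ((S : bop H) x) y| <= r * (rnorm x * rnorm y).
  apply: filterS Fr => S Sr; rewrite (le_trans (CauchySchwarz _ _))// mulrA.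
  by rewrite ler_wpM2r ?rnorm_ge0//; exact: sa_ball_rnorm.
have lims (x y : H) : exists l, `|l| <= r * (rnorm x * rnorm y) /\
    (fun S : bop H => reip (S x) y) @ F --> l.
  by have [l h1 h2] := ultra_bounded_cvg FU (bnd x y); exists l.
pose b (x y : H) : R := sval (cid (lims x y)).
have bP (x y : H) : `|b x y| <= r * (rnorm x * rnorm y) /\
    (fun S : bop H => reip (S x) y) @ F --> b x y by exact: (svalP (cid (lims x y))).
have bb (x y : H) : `|b x y| <= r * (rnorm x * rnorm y) by have [] := bP x y.
have bl (x y : H) : (fun S : bop H => reip (S x) y) @ F --> b x y by have [] := bP x y.
have blE (x y : H) l : (fun S : bop H => reip (S x) y) @ F --> l -> b x y = l.
  by move=> h; rewrite -(cvg_lim (@Rhausdorff R) h) -(cvg_lim (@Rhausdorff R) (bl x y)).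
have coeff (x : H) : exists z, forall y, b x y = reip z y.
  apply: (@riesz _ _ _ (r * rnorm x)) => [y z|a y|y].
  - by apply: blE; under eq_fun do rewrite reipDr; apply: cvgD.
  - by apply: blE; under eq_fun do rewrite reipZr; apply: cvgM; [exact: cvg_cst|].
  - by rewrite -mulrA.
have [t tP] := choice coeff.
have tl : linear t.
  move=> a x y; apply: reip_ext => z; rewrite -tP; apply: blE.
  have E u v : reip (a *: u + v) z = reip u (Num.conj a *: z) + reip v z.
    rewrite reipDl; congr (_ + _).
    by rewrite /reip linearZl_LR linearZr_LR /= conjCK.
  rewrite E -!tP; under eq_fun do rewrite bop_linear E.
  by apply: cvgD.
have tr (x : H) : rnorm (t x) <= r * rnorm x.
  have := bb x (t x); rewrite tP -rnorm_sqr ger0_norm ?sqr_ge0//.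
  have [->|b0] := eqVneq (rnorm (t x)) 0; first by rewrite mulr_ge0 ?rnorm_ge0.
  have pb : 0 < rnorm (t x) by rewrite lt_neqAle eq_sym b0 rnorm_ge0.
  by rewrite expr2 mulrA ler_pM2r.
have Tsa : is_adjoint (mkbop tl tr) (mkbop tl tr).
  apply/is_adjointP => x y /=; rewrite -tP reipC -tP; apply: blE.
  apply: cvg_trans (bl y x); apply: near_eq_cvg.
  by apply: filterS Fr => S [/is_adjointP Ssa _]; rewrite Ssa reipC.
exists (mkbop tl tr).
  split=> // x; rewrite /= (le_trans (CauchySchwarz _ _))//.
  by rewrite expr2 mulrA ler_wpM2r ?rnorm_ge0.
apply/bop_cvgP => x y.
apply: (@dominated_series_limit _ _ F _ (fun (S : bop H) n => reip (S (x n)) (y n))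
  (fun n => reip (t (x n)) (y n)) (fun n => r * (rnorm (x n) * rnorm (y n)))).
- apply: filterS Fr => S Sr n; apply: uw_term_le => z; exact: sa_ball_rnorm.
- by move=> n; apply: (uw_term_le (T := mkbop tl tr)).
- exact: (@uw_dominant_cvg _ _ r x y).
- by move=> n /=; rewrite -tP.
Qed.

End BanachAlaoglu.

(** * Elements of a dual operator system *)

Section DualOperatorSystems.
Variables (R : realType) (M : dualOperatorSystem R).
Implicit Types x y : M.

HB.instance Definition _ := isPointed.Build (dos_elt M) 0.

Lemma dos_eqP x y : (dos_val x = dos_val y) -> x = y.
Proof. exact: val_inj. Qed.

Lemma dos_addE x y u : (x + y : M) u = x u + y u.
Proof. by []. Qed.
Lemma dos_oppE x u : (- x : M) u = - x u.
Proof. by []. Qed.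
Lemma dos_scaleE (a : R[i]) x u : (a *: x : M) u = a *: x u.
Proof. by []. Qed.

Lemma dos_cvg_val (F : set_system M) x : Filter F ->
  F --> x <-> @dos_val R M @ F --> dos_val x.
Proof. by move=> FF; exact: (@cvg_initial _ _ _ F x FF). Qed.

Lemma dos_cvgP (F : set_system M) x : Filter F ->
  F --> x <-> forall a b, (fun y : M => uw y a b) @ F --> uw x a b.
Proof. by move=> FF; rewrite dos_cvg_val bop_cvgP. Qed.

Lemma dos_cvg_reip (F : set_system M) x a b : Filter F ->
  F --> x -> (fun y : M => reip ((y : bop _) a) b) @ F --> reip ((x : bop _) a) b.
Proof. by move=> FF /dos_cvg_val /bop_cvg_reip; apply. Qed.

Lemma dos_cvg_unique (F : set_system M) x y : ProperFilter F ->
  F --> x -> F --> y -> x = y.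
Proof.
move=> FF /dos_cvg_val Fx /dos_cvg_val Fy; apply: dos_eqP.
exact: bop_cvg_unique Fx Fy.
Qed.

Definition dos_ball (r : R) : set M := [set x | sa_ball r (x : bop _)].

Lemma dos_ball_ultra_cvg (r : R) (F : set_system M) : UltraFilter F ->
  0 <= r -> F (dos_ball r) -> exists2 x, dos_ball r x & F --> x.
Proof.
move=> FU r0 Fr.
have [T Tr FT] := sa_ball_ultra_cvg (ultra_fmap (@dos_val R M) FU) r0 Fr.
have TM : dos_set M T.
  apply: (@closed_cvg _ _ F _ (@dos_val R M) (dos_set M) (dos_closed M) _ _ FT).
  by apply: nearW => y; exact: set_mem (dos_valP y).
by exists (DosElt (mem_set TM)) => //; apply/dos_cvg_val.
Qed.

Lemma dos_ball_compact (r : R) : 0 <= r -> compact (dos_ball r).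
Proof.
move=> r0; rewrite compact_ultra => F FU Fr.
by have [x xr Fx] := dos_ball_ultra_cvg FU r0 Fr; exists x.
Qed.

Lemma dos_ballE (r : R) x : dos_ball r x <->
  dos_positive (r%:C *: dos_one M - x) /\ dos_positive (r%:C *: dos_one M + x).
Proof. exact: sa_ballP. Qed.

Lemma dos_ball_sa (r : R) x : dos_ball r x -> dos_sa x.
Proof. by case. Qed.

Lemma dos_sa_ball x : dos_sa x -> exists2 r, 0 <= r & dos_ball r x.
Proof. exact: sa_in_ball. Qed.

Lemma dos_ball1E : [set x | dos_sa x /\ opnorm x <= 1] = dos_ball 1.
Proof. by apply/seteqP; split => x /sa_ball1E. Qed.

Lemma dos_ball0 (r : R) : 0 <= r -> dos_ball r 0.
Proof.
move=> r0; split; last by move=> z; rewrite reip0l normr0 mulr_ge0 ?sqr_ge0.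
by move=> a b; rewrite linear0l linear0r.
Qed.

Lemma dos_ball_le (r s : R) : r <= s -> dos_ball r `<=` dos_ball s.
Proof.
move=> rs x [xsa xr]; split=> // z; apply: le_trans (xr z) _.
by rewrite ler_wpM2r ?sqr_ge0.
Qed.

Lemma dos_ballZ (r t : R) x : dos_ball r x -> dos_ball (`|t| * r) (t%:C *: x).
Proof.
move=> [xsa xr]; split; first exact: sa_Z.
by move=> z; rewrite dos_scaleE reipZl normrM -mulrA ler_wpM2l.
Qed.

Lemma dos_ballD (r s : R) x y :
  dos_ball r x -> dos_ball s y -> dos_ball (r + s) (x + y).
Proof.
move=> [xsa xr] [ysa ys]; split; first exact: sa_D.
by move=> z; rewrite dos_addE reipDl mulrDl (le_trans (ler_normD _ _))// lerD.
Qed.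

Lemma dos_ballN (r : R) x : dos_ball r x -> dos_ball r (- x).
Proof.
move=> [xsa xr]; split; first exact: sa_N.
by move=> z; rewrite dos_oppE reipNl normrN.
Qed.

Lemma dos_saD x y : dos_sa x -> dos_sa y -> dos_sa (x + y).
Proof. exact: sa_D. Qed.
Lemma dos_saZ (t : R) x : dos_sa x -> dos_sa (t%:C *: x).
Proof. exact: sa_Z. Qed.

Lemma dos_adjoint x : exists y, is_adjoint x y.
Proof.
have xM : dos_set M x := set_mem (dos_valP x).
have := xM; rewrite -(dos_selfadjoint M) => -[T TM Tx].
by exists (DosElt (mem_set TM)); exact: is_adjoint_sym.
Qed.

Lemma dos_cartesian x : exists a b, [/\ dos_sa a, dos_sa b & x = a + 'i *: b].
Proof.
have [y /is_adjointP xy] := dos_adjoint x.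
pose h : R := 2^-1.
have yx u v : reip ((y : bop _) u) v = reip u ((x : bop _) v).
  by rewrite reipC -xy reipC.
exists (h%:C *: (x + y)), (h%:C *: ('i *: (y - x))); split.
- apply/is_adjointP => u v.
  by rewrite !dos_scaleE reipZl reipZr !dos_addE reipDl reipDr xy yx addrC.
- apply/is_adjointP => u v.
  rewrite !dos_scaleE reipZl reipZr reip_il !dos_addE !dos_oppE scalerDr scalerN.
  rewrite -!bop_Z !(reipDl, reipDr, reipNl, reipNr) -xy -yx; ring.
- rewrite !scalerA mulrAC -expr2 sqr_i mulN1r scaleNr -scalerN opprB -scalerDr.
  rewrite addrACA subrr addr0 scalerDr -scalerDl -rmorphD /=.
  by rewrite (_ : h + h = 1) ?rmorph1 ?scale1r// /h; field.
Qed.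

End DualOperatorSystems.

(** * Hahn-Banach on null sequences *)

Section SequenceFunctionals.
Variable R : realType.
Implicit Types (D : set ((nat -> R) * R)) (v w e : nat -> R).

Definition combination_closed D := forall (t : R) v r w s, D (v, r) -> D (w, s) ->
  D ((fun j => t * v j + w j), t * r + s).

(** A bound by the supremum norm for the functional with graph [D]. One
    inequality is enough because [D] is stable under negation where this is
    used. *)
Definition sup_dominated D := forall v r (B : R), D (v, r) ->
  (forall j, `|v j| <= B) -> r <= B.

Definition graph_extend D e (c : R) : set ((nat -> R) * R) :=
  [set p | exists t v r, D (v, r) /\ p = ((fun j => v j + t * e j), r + t * c)].

Lemma graph_extend_closed D e c :
  combination_closed D -> combination_closed (graph_extend D e c).
Proof.
move=> Dc t _ _ _ _ [t1 [v [r [Dv [-> ->]]]]] [t2 [w [s [Dw [-> ->]]]]].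
exists (t * t1 + t2), (fun j => t * v j + w j), (t * r + s); split; first exact: Dc.
by congr pair; [apply/funext => j|]; ring.
Qed.

(** One step of the Hahn-Banach theorem, for linear functionals given by their
    graph on a space of sequences and dominated by the supremum norm. *)
Lemma hahn_banach_step D e (C : R) : combination_closed D -> D (fun=> 0, 0) ->
  sup_dominated D -> (forall j, `|e j| <= C) ->
  exists c, sup_dominated (graph_extend D e c).
Proof.
move=> Dc D0 Dd eC.
pose L := [set x | exists v r B, [/\ D (v, r), forall j, `|v j - e j| <= B & x = r - B]].
have sep v r B w s B' : D (v, r) -> (forall j, `|v j - e j| <= B) ->
    D (w, s) -> (forall j, `|w j + e j| <= B') -> r - B <= B' - s.
  move=> Dv vB Dw wB; suff : 1 * r + s <= B + B' by lra.
  apply: (Dd _ _ _ (Dc 1 _ _ _ _ Dv Dw)) => j.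
  rewrite (_ : 1 * v j + w j = (v j - e j) + (w j + e j)); last by ring.
  by rewrite (le_trans (ler_normD _ _))// lerD.
have L_ne : L !=set0.
  by exists (0 - C), (fun=> 0), 0, C; split=> // j; rewrite sub0r normrN.
have L_ub w s B' : D (w, s) -> (forall j, `|w j + e j| <= B') -> ubound L (B' - s).
  by move=> Dw wB _ [v [r [B [Dv vB ->]]]]; exact: sep vB Dw wB.
have L_sup : has_sup L.
  split=> //; exists (C - 0); apply: (L_ub (fun=> 0)) => // j.
  by rewrite add0r.
exists (sup L) => _ _ B [t [v [r [Dv [-> ->]]]]] vB.
have scale (a : R) : D (fun j => a * v j, a * r).
  have := Dc a _ _ _ _ Dv D0; rewrite addr0.
  by under [X in D (X, _)]eq_fun do rewrite addr0.
have [t0|t0|t0] := ltgtP t 0.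
- have pt : 0 < - t by rewrite oppr_gt0.
  have : L ((- t)^-1 * r - (- t)^-1 * B).
    exists (fun j => (- t)^-1 * v j), ((- t)^-1 * r), ((- t)^-1 * B); split=> // j.
    rewrite (_ : _ - _ = (- t)^-1 * (v j + t * e j)); last by field; rewrite lt_eqF.
    by rewrite normrM ger0_norm ?invr_ge0 ?(ltW pt)// ler_pM2l ?invr_gt0.
  move=> /(sup_upper_bound L_sup); rewrite -mulrBr ler_pdivrMl//; lra.
- have : ubound L (t^-1 * B - t^-1 * r).
    apply: (L_ub (fun j => t^-1 * v j)) => // j.
    rewrite (_ : _ + _ = t^-1 * (v j + t * e j)); last by field; rewrite gt_eqF.
    by rewrite normrM ger0_norm ?invr_ge0 ?(ltW t0)// ler_pM2l ?invr_gt0.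
  move=> /(ge_sup L_ne); rewrite -mulrBr ler_pdivlMl//; lra.
- rewrite t0 mul0r addr0; apply: (Dd _ _ _ Dv) => j.
  by have := vB j; rewrite t0 mul0r addr0.
Qed.

Definition unit_seq (n j : nat) : R := (j == n)%:R.

Definition graph_next D n (c : R) := graph_extend D (unit_seq n) c.

(** A value at the [n]-th unit sequence for which the extended functional is
    still dominated. *)
Definition graph_coef D n : R :=
  xget 0 [set c | sup_dominated (graph_next D n c)].

Fixpoint graph_iter D n : set ((nat -> R) * R) :=
  if n is m.+1 then graph_next (graph_iter D m) m (graph_coef (graph_iter D m) m)
  else D.

Lemma graph_iterP D n : combination_closed D -> D (fun=> 0, 0) ->
  sup_dominated D -> [/\ combination_closed (graph_iter D n),
    graph_iter D n (fun=> 0, 0) & sup_dominated (graph_iter D n)].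
Proof.
move=> Dc D0 Dd; elim: n => [|n [Ic I0 Id]] //=; split.
- exact: graph_extend_closed.
- exists 0, (fun=> 0), 0; split=> //; congr pair; last by rewrite mul0r addr0.
  by apply/funext => j; rewrite mul0r addr0.
- have u1 j : `|unit_seq n j| <= 1.
    by rewrite /unit_seq; case: (j == n); rewrite ?normr1 ?normr0.
  have [c cP] := hahn_banach_step Ic I0 Id u1.
  exact: (@xgetPex _ 0 [set c | sup_dominated (graph_next (graph_iter D n) n c)]
    (ex_intro _ c cP)).
Qed.

(** A functional on a space of sequences, dominated by the supremum norm, is
    given by an absolutely summable sequence up to tails: extending it
    successively to the unit sequences produces the coefficients. On sequences
    tending to [0] this is the duality between null and summable sequences. *)
Lemma sup_dominated_coefficients D : combination_closed D -> D (fun=> 0, 0) ->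
  sup_dominated D -> exists lam : nat -> R,
    (forall n, \sum_(0 <= j < n) `|lam j| <= 1) /\
    forall v r n (B : R), D (v, r) -> (forall j, (n <= j)%N -> `|v j| <= B) ->
      r - \sum_(0 <= j < n) lam j * v j <= B.
Proof.
move=> Dc D0 Dd; pose lam n := graph_coef (graph_iter D n) n.
have inG v r n (t : nat -> R) : D (v, r) ->
    graph_iter D n (fun j => v j + (if (j < n)%N then t j else 0),
      r + \sum_(0 <= j < n) lam j * t j).
  move=> Dv; elim: n => [|n IH].
    rewrite big_geq// addr0 /= (_ : (fun j => _) = v)//.
    by apply/funext => j; rewrite addr0.
  exists (t n), (fun j => v j + (if (j < n)%N then t j else 0)),
    (r + \sum_(0 <= j < n) lam j * t j); split=> //.
  rewrite big_nat_recr//= addrA [t n * _]mulrC; congr pair; apply/funext => j.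
  rewrite /unit_seq -addrA ltnS; congr (_ + _).
  by case: ltngtP => [_|_|->]; rewrite ?mulr0 ?addr0// add0r mulr1.
exists lam; split=> [n|v r n B Dv vB].
  have [_ _ Id] := graph_iterP n Dc D0 Dd.
  have := Id _ _ 1 (inG _ _ n (fun j => Num.sg (lam j)) D0).
  rewrite add0r; under eq_bigr do rewrite mulrC -normrEsg.
  apply => j; rewrite add0r; case: ifP => _; last by rewrite normr0.
  by rewrite normr_sg; case: (_ == _).
have [_ _ Id] := graph_iterP n Dc D0 Dd.
have := Id _ _ B (inG _ _ n (fun j => - v j) Dv).
under eq_bigr do rewrite mulrN; rewrite sumrN; apply => j.
case: ltnP => [jn|nj]; last by rewrite addr0 vB.
by rewrite subrr normr0 (le_trans _ (vB n (leqnn n))).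
Qed.

End SequenceFunctionals.

(** * The Krein-Smulian theorem *)

Lemma compact_finite_subcover (T : ptopologicalType) (I : choiceType) (K : set T)
    (D : set I) (U : I -> set T) : compact K ->
  (forall i, D i -> open (U i)) -> K `<=` cover D U ->
  exists2 s : seq I, (forall i, i \in s -> D i) &
    forall x, K x -> exists2 i, i \in s & U i x.
Proof.
rewrite compact_cover => Kc Uo KU; have [s sD sU] := Kc _ _ _ Uo KU.
exists (finmap.enum_fset s) => [i /sD/set_mem //|x /sU[i is_ Uix]].
by exists i.
Qed.

(** The lists [s m] are the increments of the chain [G]. An entry listed after
    [G n] lies in a later increment, so that bounds on the increments become a
    rate of decay of the sequence. *)
Lemma enumerate_chain (T : eqType) (x0 : T) (G s : nat -> seq T) :
  G 0 = [::] -> (forall n, G n.+1 = G n ++ s n) -> (forall n, s n != [::]) ->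
  exists zeta : nat -> T,
    (forall n z, z \in G n -> exists j, z = zeta j) /\
    (forall n j, (size (G n) <= j)%N -> exists2 m, (n <= m)%N & zeta j \in s m).
Proof.
move=> G0 GS s0.
have prefix n m : (n <= m)%N -> exists t, G m = G n ++ t.
  elim: m => [|m IH]; first by rewrite leqn0 => /eqP ->; exists [::]; rewrite cats0.
  rewrite leq_eqVlt => /orP[/eqP ->|]; first by exists [::]; rewrite cats0.
  by rewrite ltnS => /IH[t Gm]; exists (t ++ s m); rewrite GS Gm catA.
have size_mono n m : (n <= m)%N -> (size (G n) <= size (G m))%N.
  by move=> /prefix[t ->]; rewrite size_cat leq_addr.
have size_ge n : (n <= size (G n))%N.
  elim: n => // n IH; rewrite GS size_cat; case: (s n) (s0 n) => //= a l _.
  by rewrite addnS ltnS (leq_trans IH)// leq_addr.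
have nthE n m j : (n <= m)%N -> (j < size (G n))%N -> nth x0 (G m) j = nth x0 (G n) j.
  by move=> /prefix[t ->] jn; rewrite nth_cat jn.
exists (fun j => nth x0 (G j.+1) j); split=> [n z zG|n j nj].
  exists (index z (G n)); set j := index z (G n).
  have jn : (j < size (G n))%N by rewrite index_mem.
  rewrite -(nthE _ (maxn n j.+1)) ?leq_maxr ?size_ge//.
  by rewrite (nthE n) ?leq_maxl// nth_index.
have ex : exists m, (j < size (G m))%N by exists j.+1; exact: size_ge.
case: (ex_minnP ex) => -[|m]; first by rewrite G0.
move=> jm min_m.
have mj : (size (G m) <= j)%N.
  by rewrite leqNgt; apply/negP => /min_m; rewrite ltnn.
exists m.
  rewrite leqNgt; apply/negP => /size_mono h.
  by have := leq_trans jm (leq_trans h nj); rewrite ltnn.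
have mj1 : (m.+1 <= j.+1)%N by rewrite ltnS (leq_trans (size_ge m)).
rewrite (nthE _ _ _ mj1 jm) GS nth_cat ltnNge mj /=.
by apply: mem_nth; rewrite ltn_subLR// -size_cat -GS.
Qed.

Section KreinSmulian.
Variables (R : realType) (M : dualOperatorSystem R).
Implicit Types (x y : M) (z : dos_space M).

Definition quad z x : R := reip ((x : bop _) z) z.

Lemma quadD z x y : quad z (x + y) = quad z x + quad z y.
Proof. by rewrite /quad dos_addE reipDl. Qed.
Lemma quadZ z (t : R) x : quad z (t%:C *: x) = t * quad z x.
Proof. by rewrite /quad dos_scaleE reipZl. Qed.
Lemma quad_scale (t : R) z x : quad (t%:C *: z) x = t ^+ 2 * quad z x.
Proof. by rewrite /quad bop_Z reipZl reipZr mulrA expr2. Qed.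
Lemma quad_continuous z : continuous (quad z : M -> R).
Proof. by move=> x; exact: (@dos_cvg_reip R M (nbhs x) x z z _ (@cvg_id _ _)). Qed.

Lemma quad_ext x y : dos_sa x -> dos_sa y ->
  (forall z, quad z x = quad z y) -> x = y.
Proof.
move=> xsa ysa xy; have h : dos_ball 0 (x - y).
  have [s s0 xs] := dos_sa_ball xsa; have [t t0 yt] := dos_sa_ball ysa.
  split; first by case: (dos_ballD xs (dos_ballN yt)).
  by move=> z; rewrite mul0r dos_addE dos_oppE reipDl reipNl -/(quad z x) xy subrr normr0.
apply/eqP; rewrite -subr_eq0; apply/eqP/dos_eqP/bop_eqP => z.
by apply: rnorm_eq0; apply/eqP; rewrite -normr_le0 ger0_norm ?rnorm_ge0//;
  rewrite -[leRHS](mul0r (rnorm z)); exact: sa_ball_rnorm h.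
Qed.

(** Ultrafilters are enough to test continuity on the balls, and since these are
    compact every ultrafilter containing a ball converges. *)
Definition ball_continuous (T : topologicalType) (g : M -> T) :=
  forall (r : R) (F : set_system M) x, UltraFilter F -> 0 <= r -> F (dos_ball r) ->
    F --> x -> g @ F --> g x.

Section RealFunctional.
Variable g : M -> R.
Hypothesis gD : forall x y, g (x + y) = g x + g y.
Hypothesis gZ : forall (t : R) x, g (t%:C *: x) = t * g x.
Hypothesis g_cont : ball_continuous g.

Let g0 : g 0 = 0.
Proof. by rewrite -[X in g X](scale0r (0 : M)) (gZ 0) mul0r. Qed.

Let level (n : nat) : set M := [set x | dos_ball n%:R x /\ g x = 1].

Let level_compact n : compact (level n).
Proof.
rewrite compact_ultra => F FU Fn.
have Fb : F (dos_ball n%:R) by apply: filterS Fn => x [].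
have [x xn Fx] := dos_ball_ultra_cvg FU (ler0n _ n) Fb.
exists x; split=> //; split=> //.
have gx := g_cont FU (ler0n _ n) Fb Fx.
have g1 : g @ F --> (1 : R).
  by apply: cvg_near_cst; apply: filterS Fn => y [].
by rewrite -(cvg_lim (@Rhausdorff R) gx) (cvg_lim (@Rhausdorff R) g1).
Qed.

Let polar (s : seq (dos_space M)) : set M :=
  [set x | forall z, z \in s -> `|quad z x| <= 1].

(** A point of the polar outside the ball of radius [n] is detected by a vector
    [z] with [n |z|^2 <= 1]; by compactness finitely many such vectors, added to
    [s], exclude the whole level [n.+1]. *)
Let polar_step n s : level n `&` polar s = set0 -> exists s',
  (forall z, z \in s' -> n%:R * rnorm z ^+ 2 <= 1) /\
  level n.+1 `&` polar (s ++ s') = set0.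
Proof.
move=> ns0.
pose U z := [set x | 1 < `|quad z x|].
pose D : set (dos_space M) :=
  [set z | z \in s \/ n%:R * rnorm z ^+ 2 <= 1].
have Uopen z : D z -> open (U z).
  move=> _; have /continuousP/(_ [set r | 1 < r]) :
      continuous (fun x : M => `|quad z x| : R).
    by move=> x; apply: cvg_norm; [exact: nbhs_filter|exact: quad_continuous].
  by apply; exact: open_gt.
have cover : level n.+1 `<=` cover D U.
  move=> x [xn gx].
  have [[z zs zx]|xs] := pselect (exists2 z, z \in s & 1 < `|quad z x|).
    by exists z => //; left.
  have px : polar s x.
    by move=> z zs; rewrite leNgt; apply/negP => zx; apply: xs; exists z.
  have [z zx] : exists z, n%:R * rnorm z ^+ 2 < `|quad z x|.
    apply: contrapT => nz; suff : (level n `&` polar s) x by rewrite ns0.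
    split=> //; split=> //; split; first exact: dos_ball_sa xn.
    by move=> z; rewrite leNgt; apply/negP => zx; apply: nz; exists z.
  have nz0 : 0 <= n%:R * rnorm z ^+ 2 by rewrite mulr_ge0 ?sqr_ge0.
  set q := `|quad z x| in zx; set p := n%:R * rnorm z ^+ 2 in zx nz0.
  have qp : 0 < q + p by rewrite ltr_wpDr// (le_lt_trans nz0).
  (* The square of [t] lies between [1 / q] and [1 / p], the latter infinite
     when [p = 0]. *)
  pose t := Num.sqrt (2 / (q + p)).
  have t2 : t ^+ 2 = 2 / (q + p) by rewrite sqr_sqrtr// divr_ge0// ltW.
  exists (t%:C *: z); last first.
    rewrite /U /= quad_scale normrM ger0_norm ?sqr_ge0// t2 -/q.
    by rewrite mulrAC ltr_pdivlMr//; lra.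
  right; rewrite rnormZ exprMn real_normK ?num_real// t2 mulrCA -/p.
  by rewrite mulrAC ler_pdivrMr//; lra.
have [D' D'D D'cov] := compact_finite_subcover (@level_compact n.+1) Uopen cover.
exists [seq z <- D' | n%:R * rnorm z ^+ 2 <= 1]; split.
  by move=> z; rewrite mem_filter => /andP[].
rewrite -subset0 => x [xn xp]; have [z /= zD' zx] := D'cov x xn.
suff : `|quad z x| <= 1 by rewrite leNgt zx.
apply: xp; rewrite mem_cat mem_filter; have := D'D z zD'.
by case=> [->//|->]; rewrite zD' orbT.
Qed.

(** The hyperplane [g = 1] is kept at a distance from [0] by a null sequence of
    vectors: one obtains it level by level from [polar_step], starting from the
    level [0], which is empty because [g 0 = 0]. *)
Lemma level_separating_sequence : exists zeta : nat -> dos_space M,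
  (forall n, exists N, forall j, (N <= j)%N -> n%:R * rnorm (zeta j) ^+ 2 <= 1) /\
  (forall x, dos_sa x -> g x = 1 -> exists j, 1 < `|quad (zeta j) x|).
Proof.
have next (p : nat * seq (dos_space M)) : exists s', level p.1 `&` polar p.2 = set0 ->
    (forall z, z \in s' -> p.1%:R * rnorm z ^+ 2 <= 1) /\
    level p.1.+1 `&` polar (p.2 ++ s') = set0.
  have [ns|ns] := pselect (level p.1 `&` polar p.2 = set0); last by exists [::].
  by have [s' h] := polar_step ns; exists s'.
pose pick p : seq (dos_space M) := sval (cid (next p)).
pose G := fix G n := if n is m.+1 then G m ++ 0 :: pick (m, G m) else [::].
have GP n : level n `&` polar (G n) = set0.
  elim: n => [|n IH].
    rewrite -subset0 => x [[[xsa x0] gx] _].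
    suff x_eq0 : x = 0 by move/eqP: gx; rewrite x_eq0 g0 eq_sym oner_eq0.
    apply: quad_ext => //; first exact: dos_ball_sa (dos_ball0 M (lexx 0)).
    move=> z; apply/eqP; rewrite /quad -[X in _ == reip X _]/(0 : dos_space M) reip0l.
    by rewrite -normr_le0 (le_trans (x0 z))// mul0r.
  have [_ h] := svalP (cid (next (n, G n))) IH.
  rewrite -subset0 -h => x [xn xp]; split=> // z zs; apply: xp.
  by move: zs; rewrite /= !mem_cat in_cons => /orP[->//|->]; rewrite !orbT.
have G_pick n z : z \in pick (n, G n) -> n%:R * rnorm z ^+ 2 <= 1.
  by have [h _] := svalP (cid (next (n, G n))) (GP n); exact: h.
have [zeta [zetaG zeta_late]] := @enumerate_chain _ 0 G
  (fun n => 0 :: pick (n, G n)) erefl (fun n => erefl) (fun n => isT).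
exists zeta; split=> [n|x xsa gx].
  exists (size (G n)) => j /zeta_late[m nm]; rewrite in_cons => /orP[/eqP ->|/G_pick].
    by rewrite rnorm0 expr0n mulr0.
  by apply: le_trans; rewrite ler_wpM2r ?sqr_ge0// ler_nat.
have [r r0 xr] := dos_sa_ball xsa.
have /ltW r_le := truncnS_gt r.
apply: contrapT => nz.
suff : (level (Num.truncn r).+1 `&` polar (G (Num.truncn r).+1)) x by rewrite GP.
split; first by split=> //; exact: dos_ball_le r_le _ xr.
move=> z /zetaG[j ->]; rewrite leNgt; apply/negP => zx; apply: nz.
by exists j.
Qed.

(** Krein-Smulian. The null sequence [zeta] dominates [g] by the supremum of
    [|<x zeta_j, zeta_j>|], so Hahn-Banach on null sequences writes [g] as a
    summable combination of these functionals. The equation about ['i *: x] says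
    that the functional found is real on self-adjoint elements, which makes it
    possible to treat real and imaginary parts separately. *)
Lemma ball_continuous_uw : exists a b : sqsummable (dos_space M),
  forall x, dos_sa x -> g x = uw x a b /\ uw ('i *: x : M) a b = 0.
Proof.
have [zeta [zeta0 zeta_sep]] := level_separating_sequence.
pose D := [set p : (nat -> R) * R | exists2 x, dos_sa x &
   p = ((fun j => quad (zeta j) x), g x)].
have Dc : combination_closed D.
  move=> t _ _ _ _ [x xsa [-> ->]] [y ysa [-> ->]].
  exists (t%:C *: x + y); first by apply: dos_saD => //; exact: dos_saZ.
  by rewrite gD gZ; congr pair; apply/funext => j; rewrite quadD quadZ.
have D0 : D (fun=> 0, 0).
  exists 0; first exact: dos_ball_sa (dos_ball0 M (lexx 0)).
  by rewrite g0; congr pair; apply/funext => j; rewrite /quad reip0l.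
have Dd : sup_dominated D.
  move=> _ _ B [x xsa [-> ->]] xB; rewrite leNgt; apply/negP => gB.
  have B0 : 0 <= B := le_trans (normr_ge0 _) (xB 0).
  have gx : 0 < g x := le_lt_trans B0 gB.
  have [||j] := zeta_sep ((g x)^-1%:C *: x); first exact: dos_saZ.
    by rewrite gZ mulVf// gt_eqF.
  rewrite quadZ normrM ger0_norm ?invr_ge0 ?(ltW gx)// ltr_pdivlMl// mulr1.
  by move=> /lt_le_trans/(_ (xB j)); rewrite ltNge (ltW gB).
have [lam [lam1 lamP]] := sup_dominated_coefficients Dc D0 Dd.
have lam_cvg : cvgn (series (fun j => `|lam j|)).
  exact: (bounded_series_cvg (M := 1)).
have [C zetaC] : exists C, forall j, rnorm (zeta j) ^+ 2 <= C.
  have [N zN] := zeta0 1%N.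
  exists (1 + \sum_(0 <= i < N) rnorm (zeta i) ^+ 2) => j.
  have [/zN|jN] := leqP N j.
    by rewrite mul1r => /le_trans -> //; rewrite lerDl sumr_ge0// => i _; exact: sqr_ge0.
  rewrite (bigD1_seq j) ?mem_index_iota ?iota_uniq//=.
  by rewrite addrCA lerDl addr_ge0// sumr_ge0// => i _; exact: sqr_ge0.
(* The coefficient [lam j] is split between the two copies of [zeta j]; the
   resulting sequences are square-summable because [lam] is summable and [zeta]
   bounded. *)
pose w j := Num.sqrt `|lam j|.
have w2 j : w j ^+ 2 = `|lam j| by rewrite sqr_sqrtr.
have a_sqs : cvgn (series (fun j => rnorm ((w j)%:C *: zeta j) ^+ 2) : R^nat).
  apply: (dominated_series_cvg (v := C *: (fun j => `|lam j|))).
    move=> j; rewrite ger0_norm ?sqr_ge0// rnormZ exprMn real_normK ?num_real//.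
    by rewrite w2 fctE /GRing.scale /= mulrC ler_wpM2r.
  exact: is_cvg_seriesZ.
have b_sqs : cvgn (series (fun j =>
    rnorm ((Num.sg (lam j) * w j)%:C *: zeta j) ^+ 2) : R^nat).
  apply: (dominated_series_cvg _ a_sqs) => j.
  rewrite ger0_norm ?sqr_ge0// !rnormZ normrM ler_sqr ?nnegrE ?mulr_ge0 ?rnorm_ge0//.
  by rewrite ler_wpM2r ?rnorm_ge0// ler_piMl// normr_sg; case: (_ == _).
exists (SqSummable a_sqs), (SqSummable b_sqs) => x xsa; split; last first.
  rewrite /uw (_ : (fun n => _) = (fun=> 0)).
    rewrite (_ : series _ = (fun=> 0)) ?lim_cst//.
    by apply/funext => n; rewrite /series /= big1.
  apply/funext => n; rewrite dos_scaleE reip_il /= bop_Z reipZl.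
  by rewrite scalerA (mulrC 'i) -scalerA reipZr sa_reip_i// !mulr0 oppr0.
apply/esym/(cvg_lim (@Rhausdorff R)).
have [r r0 [_ xr]] := dos_sa_ball xsa.
have xD : D ((fun j => quad (zeta j) x), g x) by exists x.
have xDN : D ((fun j => quad (zeta j) (- x)), g (- x)).
  by exists (- x) => //; exact: sa_N.
have gN : g (- x) = - g x by apply/eqP; rewrite -addr_eq0 -gD addNr g0.
have quadN j : quad (zeta j) (- x) = - quad (zeta j) x by rewrite /quad reipNl.
apply/cvgrPdist_le => e e0.
have [N zN] := zeta0 (Num.truncn (r / e)).+1.
exists N => // n /= Nn.
have tail j : (n <= j)%N -> `|quad (zeta j) x| <= e.
  move=> nj; apply: le_trans (xr _) _.
  have := zN _ (leq_trans Nn nj); set z2 := rnorm _ ^+ 2 => h.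
  have z20 : 0 <= z2 by exact: sqr_ge0.
  have /ltW := truncnS_gt (r / e); rewrite ler_pdivrMr// => re.
  apply: le_trans (ler_wpM2r z20 re) _.
  by rewrite mulrAC -[leRHS]mul1r ler_wpM2r// ltW.
have E : series (fun j => reip ((x : bop _) (SqSummable a_sqs j)) (SqSummable b_sqs j)) n =
    \sum_(0 <= j < n) lam j * quad (zeta j) x.
  apply: eq_bigr => j _ /=; rewrite bop_Z reipZl reipZr mulrA -/(quad _ _).
  by rewrite mulrCA -expr2 w2 -numEsg.
rewrite E ler_norml; apply/andP; split; last exact: lamP xD tail.
have := lamP _ _ n e xDN; rewrite gN; under eq_bigr do rewrite quadN mulrN.
rewrite sumrN => h; suff : - g x - - (\sum_(0 <= j < n) lam j * quad (zeta j) x) <= e by lra.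
by apply: h => j nj; rewrite quadN normrN tail.
Qed.

End RealFunctional.
End KreinSmulian.

(** * Normal positive maps and separation *)

Section NormalMaps.
Variables (R : realType) (M N : dualOperatorSystem R).

Lemma uw_continuous a b : continuous (fun x : M => uw x a b : R).
Proof.
move=> x; have idx : nbhs x --> x by exact: cvg_id.
exact: (dos_cvgP x (nbhs_filter x)).1 idx a b.
Qed.

Lemma dos_continuous (f : M -> N) :
  (forall x a b, (fun y => uw (f y) a b) @ x --> uw (f x) a b) -> continuous f.
Proof.
move=> h x.
apply: (dos_cvgP (f x) (fmap_filter f (nbhs_filter x))).2 => a b; exact: h.
Qed.

(** With [y = A + i B] and [A], [B] self-adjoint, the functional
    [g y = Re <f y a, b>] is [g A + g (i B)]. Krein-Smulian applies to [g] and to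
    [g (i _)] on the self-adjoint part, and each functional so obtained depends
    on one of [A] and [B] only. *)
Lemma ball_continuous_normal (f : {linear M -> N}) :
  ball_continuous f -> continuous f.
Proof.
move=> fc; apply: dos_continuous => x a b.
pose g y := uw (f y) a b; pose gi y := uw (f ('i *: y)) a b.
have giE y : gi y = - uw (f y) a (sqs_i b) by rewrite /gi linearZ uw_i.
have gD y z : g (y + z) = g y + g z by rewrite /g linearD uwD.
have gZ (t : R) y : g (t%:C *: y) = t * g y by rewrite /g linearZ uwZ.
have giD y z : gi (y + z) = gi y + gi z by rewrite /gi scalerDr linearD uwD.
have giZ (t : R) y : gi (t%:C *: y) = t * gi y.
  by rewrite /gi scalerA mulrC -scalerA linearZ uwZ.
have gc : ball_continuous g.
  move=> r F y FU r0 Fr Fy; have /dos_cvgP h := fc r F y FU r0 Fr Fy.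
  exact: h.
have gic : ball_continuous gi.
  move=> r F y FU r0 Fr Fy; have /dos_cvgP h := fc r F y FU r0 Fr Fy.
  by rewrite (funext giE); apply: cvgN; exact: h.
have [c [d cd]] := ball_continuous_uw gD gZ gc.
have [c' [d' cd']] := ball_continuous_uw giD giZ gic.
have gE y : g y = uw y c d + uw y c' (sqs_i d').
  have [A [B [Asa Bsa ->]]] := dos_cartesian y.
  rewrite gD -[g ('i *: B)]/(gi B) (cd _ Asa).1 (cd' _ Bsa).1 uwD (cd _ Bsa).2 addr0.
  congr (_ + _); rewrite -[RHS]opprK -uw_i.
  rewrite (_ : 'i *: _ = 'i *: (A : bop _) - (B : bop _) :> bop _); last first.
    rewrite -[LHS]/('i *: ((A : bop _) + 'i *: (B : bop _))).
    by rewrite scalerDr scalerA -expr2 sqr_i scaleN1r.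
  by rewrite uwD (cd' _ Asa).2 add0r uwN opprK.
rewrite -/(g x) gE -[X in X --> _]/((fun y => g y) @ x) (funext gE).
have FF := nbhs_filter x.
by apply: cvgD; [exact: (@uw_continuous c d x)|exact: (@uw_continuous c' (sqs_i d') x)].
Qed.

Section PositiveMaps.
Variable f : UPmap M N.

Lemma up_ball (r : R) x : dos_ball r x -> dos_ball r (f x).
Proof.
move=> /dos_ballE[p1 p2]; apply/dos_ballE.
by split; [have := up_positive f p1|have := up_positive f p2];
  rewrite ?linearB ?linearD linearZ /= up_unital.
Qed.

Lemma up_sa x : dos_sa x -> dos_sa (f x).
Proof. by move=> /dos_sa_ball[r _ /up_ball/dos_ball_sa]. Qed.

Lemma up_adjoint (x y : M) :
  is_adjoint x y -> is_adjoint (f x) (f y).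
Proof.
have [A [B [Asa Bsa ->]]] := dos_cartesian x => xy.
have -> : y = A - 'i *: B.
  apply: dos_eqP; apply: adjoint_unique xy _.
  move/is_adjointP: Asa => Asa; move/is_adjointP: Bsa => Bsa.
  apply/is_adjointP => a b; rewrite !dos_addE dos_oppE !dos_scaleE.
  by rewrite reipDl reipDr reipNr reip_il Asa Bsa bop_Z -reip_il.
have /is_adjointP fA := up_sa Asa; have /is_adjointP fB := up_sa Bsa.
have -> : f (A + 'i *: B) = f A + 'i *: f B by rewrite linearD linearZ.
have -> : f (A - 'i *: B) = f A - 'i *: f B by rewrite linearB linearZ.
apply/is_adjointP => a b; rewrite !dos_addE dos_oppE !dos_scaleE.
by rewrite reipDl reipDr reipNr reip_il fA fB bop_Z -reip_il.
Qed.

Lemma up_cvg (T : Type) (F : set_system T) (u : T -> M) (x : M) : Filter F ->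
  u @ F --> x -> (fun t => f (u t)) @ F --> f x.
Proof. by move=> FF ux; apply: cvg_comp ux _; exact: (@up_normal _ _ _ f x). Qed.

End PositiveMaps.

Lemma upmap_eq (f g : UPmap M N) : f =1 g -> f = g.
Proof.
case: f => f fn fu fp; case: g => g gn gu gp /= fg.
have E : f = g.
  clear fn fu fp gn gu gp; move: fg; case: f => f [[a1] [c1]]; case: g => g [[a2] [c2]] /= fg.
  have {}fg : f = g by apply/funext.
  by subst g; rewrite (Prop_irrelevance a1 a2) (Prop_irrelevance c1 c2).
subst g; congr UPMap; exact: Prop_irrelevance.
Qed.

End NormalMaps.

Section Composition.
Variable R : realType.

Lemma up_id_normal (M : dualOperatorSystem R) : continuous (@idfun M).
Proof. by move=> x; exact: cvg_id. Qed.

Definition up_id (M : dualOperatorSystem R) : UPmap M M :=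
  @UPMap R M M idfun (@up_id_normal M) erefl (fun x => id).

Variables M N P : dualOperatorSystem R.
Variables (g : UPmap N P) (f : UPmap M N).

Lemma up_comp_normal : continuous (g \o f).
Proof.
move=> x; apply: cvg_comp; first exact: (@up_normal _ _ _ f x).
exact: (@up_normal _ _ _ g (f x)).
Qed.

Lemma up_comp_unital : (g \o f) (dos_one M) = dos_one P.
Proof. by rewrite /= !up_unital. Qed.

Lemma up_comp_positive x : dos_positive x -> dos_positive ((g \o f) x).
Proof. by move=> /(up_positive f)/(up_positive g). Qed.

Definition up_comp : UPmap M P :=
  @UPMap R M P (g \o f) up_comp_normal up_comp_unital up_comp_positive.

End Composition.

Fixpoint up_iter (R : realType) (M : dualOperatorSystem R) (f : UPmap M M)
  (n : nat) : UPmap M M := if n is m.+1 then up_comp f (up_iter f m) else up_id M.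

Lemma up_iterE (R : realType) (M : dualOperatorSystem R) (f : UPmap M M) n x :
  up_iter f n x = iter n f x.
Proof. by elim: n => //= n ->. Qed.

Section SelfAdjointNorm.
Variables (R : realType) (M N : dualOperatorSystem R).

Lemma sa_normE (f : N -> R[i]) :
  sa_norm f = sup [set rnorm (f x) | x in dos_ball 1].
Proof. by rewrite /sa_norm dos_ball1E. Qed.

Lemma sa_norm_le (f : N -> R[i]) (c : R) :
  (forall x, dos_ball 1 x -> rnorm (f x) <= c) -> sa_norm f <= c.
Proof.
move=> fc; rewrite sa_normE; apply: ge_sup; last by move=> _ [x xb <-]; exact: fc.
by exists (rnorm (f 0)), 0 => //; exact: dos_ball0.
Qed.

Lemma continuous_ball_max (k : N -> R) : continuous k ->
  exists2 c, dos_ball 1 c & forall x, dos_ball 1 x -> k x <= k c.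
Proof.
move=> kc; have [|||c /set_mem cb cmax] := @compact_EVT_max N R k (dos_ball 1).
- by exists 0; exact: dos_ball0.
- exact: dos_ball_compact.
- exact: continuous_subspaceT.
by exists c => // x xb; apply: cmax; exact/mem_set.
Qed.

Lemma sa_norm_ge (rho : predual M) (f : UPmap N M) x : dos_ball 1 x ->
  rnorm (rho (f x)) <= sa_norm (rho \o f).
Proof.
move=> xb; rewrite sa_normE; apply: ub_le_sup; last by exists x.
have kc : continuous (fun y : N => `|complex.Re (rho (f y))| + `|complex.Im (rho (f y))| : R).
  move=> y; have fy := @up_normal _ _ _ f y.
  have rf : (fun t => rho (f t) : R[i]^o) @ y --> (rho (f y) : R[i]^o).
    by apply: cvg_comp fy _; exact: (@predual_normal _ _ rho (f y)).
  have FF := nbhs_filter y; have /cvg_complexP[h1 h2] := rf.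
  have h : (fun t => `|complex.Re (rho (f t))| + `|complex.Im (rho (f t))|) @ nbhs y -->
      `|complex.Re (rho (f y))| + `|complex.Im (rho (f y))|.
    by apply: cvgD; apply: cvg_norm.
  exact: h.
have [c _ cmax] := continuous_ball_max kc.
exists (`|complex.Re (rho (f c))| + `|complex.Im (rho (f c))|) => _ [y yb <-].
exact: le_trans (rnorm_le_ReIm _) (cmax y yb).
Qed.

End SelfAdjointNorm.

Section Separation.
Variables (R : realType) (M : dualOperatorSystem R).

Section VectorStates.
Variables (s : seq (dos_space M)) (c : dos_space M -> R).

Definition vector_states (x : M) : R[i] :=
  \sum_(z <- s) (c z)%:C * inner ((x : bop _) z) z.

Lemma vector_states_linear : scalar vector_states.
Proof.
move=> a x y; have E z : inner ((a *: x + y : M) z) z =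
    a * inner ((x : bop _) z) z + inner ((y : bop _) z) z.
  by rewrite -[(a *: x + y : M) z]/(a *: (x : bop _) z + (y : bop _) z) linearDl linearZl_LR.
rewrite /vector_states; under eq_bigr do rewrite E mulrDr mulrCA.
by rewrite big_split /= mulr_sumr.
Qed.

HB.instance Definition _ := GRing.isLinear.Build R[i] M R[i] _ vector_states
  vector_states_linear.

Lemma vector_states_Re x :
  complex.Re (vector_states x) = \sum_(z <- s) c z * quad z x.
Proof.
rewrite /vector_states (big_morph _ (@ReD R) (erefl : complex.Re 0 = 0)).
by apply: eq_bigr => z _; rewrite ReZ.
Qed.

Lemma vector_states_Im x :
  complex.Im (vector_states x) = \sum_(z <- s) c z * reip ((x : bop _) z) ('i *: z).
Proof.
rewrite /vector_states (big_morph _ (@ImD R) (erefl : complex.Im 0 = 0)).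
by apply: eq_bigr => z _; rewrite ImZ Im_inner.
Qed.

Lemma vector_states_normal : continuous (vector_states : M -> R[i]^o).
Proof.
move=> x; apply/(cvg_complexP (nbhs_filter x)).
rewrite vector_states_Re vector_states_Im.
under eq_fun do rewrite vector_states_Re.
under [X in _ /\ X @ _ --> _]eq_fun do rewrite vector_states_Im.
split.
  elim: s => [|z l IH]; first by rewrite big_nil; under eq_fun do rewrite big_nil; exact: cvg_cst.
  rewrite big_cons; under eq_fun do rewrite big_cons.
  apply: cvgD => //; apply: cvgM; [exact: cvg_cst|exact: quad_continuous].
elim: s => [|z l IH]; first by rewrite big_nil; under eq_fun do rewrite big_nil; exact: cvg_cst.
rewrite big_cons; under eq_fun do rewrite big_cons.
apply: cvgD => //; apply: cvgM; first exact: cvg_cst.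
by apply: (@dos_cvg_reip R M (nbhs x) x); exact: cvg_id.
Qed.

Definition vector_states_predual : predual M := @Predual R M vector_states vector_states_normal.

Lemma vector_states_sa x : dos_sa x ->
  rnorm (vector_states x) = `|\sum_(z <- s) c z * quad z x|.
Proof.
move=> xsa; rewrite rnormcE vector_states_Re vector_states_Im.
rewrite [X in _ + X ^+ 2]big1 ?expr0n ?addr0 ?sqrtr_sqr// => z _.
by rewrite sa_reip_i// mulr0.
Qed.

End VectorStates.

(** Bipolar theorem for images of unit balls. A point [p] outside the compact
    convex set [f1 (ball)] differs from each of its points on one of finitely
    many vector states; the point of [f1 (ball)] closest to [p] in the
    Euclidean distance defined by those states gives a separating functional. *)
Lemma image_ball_subset (N1 N2 : dualOperatorSystem R)
    (f1 : UPmap N1 M) (f2 : UPmap N2 M) :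
  (forall rho : predual M, sa_norm (rho \o f2) <= sa_norm (rho \o f1)) ->
  forall y2, dos_ball 1 y2 -> exists2 y1, dos_ball 1 y1 & f1 y1 = f2 y2.
Proof.
move=> norms y2 y2b; set p := f2 y2; apply: contrapT => p_out.
pose U z := [set x : N1 | quad z (f1 x) != quad z p].
have qc z : continuous (fun x : N1 => quad z (f1 x)).
  by move=> x; apply: cvg_comp; [exact: (@up_normal _ _ _ f1 x)|exact: quad_continuous].
have Uopen z : setT z -> open (U z).
  move=> _; have /continuousP := qc z.
  by move=> /(_ [set r | r != quad z p]); apply; exact: open_neq.
have psa : dos_sa p by apply: up_sa; exact: dos_ball_sa y2b.
have cover : dos_ball 1 `<=` cover setT U.
  move=> x xb; apply: contrapT => nz; apply: p_out; exists x => //.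
  apply: quad_ext => //; first by apply: up_sa; exact: dos_ball_sa xb.
  by move=> z; apply/eqP/negP => /negP zx; apply: nz; exists z.
have [s _ sU] := compact_finite_subcover (dos_ball_compact ler01) Uopen cover.
pose dist2 x : R := \sum_(z <- s) (quad z (f1 x) - quad z p) ^+ 2.
have dist2c : continuous (fun x => - dist2 x).
  move=> x; have FF := nbhs_filter x.
  suff h : (fun t => dist2 t) @ nbhs x --> dist2 x by exact: cvgN h.
  rewrite /dist2; elim: (s) => [|z l IH].
    by rewrite big_nil; under eq_fun do rewrite big_nil; exact: cvg_cst.
  rewrite big_cons; under eq_fun do rewrite big_cons.
  apply: cvgD => //; rewrite expr2; under eq_fun do rewrite expr2.
  by apply: cvgM; apply: cvgB; [exact: (qc z x)|exact: cvg_cst|exact: (qc z x)|exact: cvg_cst].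
have [q qb qmin] := continuous_ball_max dist2c.
pose c z := quad z p - quad z (f1 q).
pose h y : R := \sum_(z <- s) c z * quad z y.
(* First-order optimality of [q]: if [S > 0], the step [t] towards [x] makes the
   quadratic term [t^2 D] smaller than the linear gain [2 t S]. *)
have hmax x : dos_ball 1 x -> h (f1 x) <= h (f1 q).
  move=> xb; pose d z := quad z (f1 x) - quad z (f1 q).
  set S := h (f1 x) - h (f1 q); rewrite -subr_le0 -/S leNgt; apply/negP => S0.
  have SE : S = \sum_(z <- s) c z * d z.
    by rewrite /S /h -sumrB; apply: eq_bigr => z _; rewrite mulrBr.
  pose D := \sum_(z <- s) d z ^+ 2.
  have D0 : 0 <= D by rewrite sumr_ge0// => z _; exact: sqr_ge0.
  pose t := S / (S + D).
  have SD : 0 < S + D by rewrite ltr_wpDr.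
  have t0 : 0 < t by rewrite divr_gt0.
  have t1 : t <= 1 by rewrite ler_pdivrMr// mul1r lerDl.
  have := qmin ((1 - t)%:C *: q + t%:C *: x).
  have b1 : dos_ball 1 ((1 - t)%:C *: q + t%:C *: x).
    have := dos_ballD (dos_ballZ (1 - t) qb) (dos_ballZ t xb).
    by rewrite !mulr1 !ger0_norm ?subr_ge0// ?(ltW t0)// subrK.
  move=> /(_ b1); rewrite lerN2 => le.
  have : dist2 ((1 - t)%:C *: q + t%:C *: x) = dist2 q - 2 * t * S + t ^+ 2 * D.
    rewrite /dist2 SE /D !mulr_sumr -sumrB -big_split; apply: eq_bigr => z _ /=.
    have -> : quad z (f1 ((1 - t)%:C *: q + t%:C *: x)) =
        (1 - t) * quad z (f1 q) + t * quad z (f1 x).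
      by rewrite linearD !linearZ quadD !quadZ.
    by rewrite /c /d; ring.
  move=> E; move: le; rewrite E -addrA lerDl => le.
  have tD : t * D <= S by rewrite /t mulrAC ler_pdivrMr// ler_pM2l// lerDr ltW.
  have : 0 <= t * (t * D - 2 * S) by move: le; lra.
  by rewrite pmulr_rge0//; lra.
have hp : h (f1 q) < h p.
  rewrite -subr_gt0 /h -sumrB (_ : \sum_(z <- s) _ = \sum_(z <- s) c z ^+ 2); last first.
    by apply: eq_bigr => z _; rewrite /c; ring.
  have [z zs zq] := sU q qb.
  rewrite (big_rem z)//= ltr_pwDl ?sumr_ge0// => [|w _]; last exact: sqr_ge0.
  by rewrite exprn_even_gt0//= /c subr_eq0 eq_sym.
have hN x : dos_ball 1 x -> - h (f1 x) <= h (f1 q).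
  move=> xb; have := hmax _ (dos_ballN xb); congr (_ <= _).
  rewrite /h -sumrN; apply: eq_bigr => z _.
  by rewrite linearN /quad dos_oppE reipNl mulrN.
have := norms (vector_states_predual s c); apply/negP; rewrite -ltNge.
apply: (@le_lt_trans _ _ (h (f1 q))).
  apply: sa_norm_le => x xb; rewrite /= vector_states_sa; last first.
    by apply: up_sa; exact: dos_ball_sa xb.
  by rewrite ler_norml hmax// andbT lerNl hN.
apply: lt_le_trans (sa_norm_ge (vector_states_predual s c) f2 y2b).
by rewrite /= vector_states_sa// (lt_le_trans hp)// ler_norm.
Qed.

End Separation.

(** * Uniqueness of the asymptotic lift *)

Section Lifts.
Variables (R : realType) (M : dualOperatorSystem R) (phi : UPmap M M).

Section OneLift.
Variable L : reversible_lift phi.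
Local Notation alpha := (lift_aut L).
Local Notation beta := (upi_inv (lift_aut L)).
Local Notation E := (lift_map L).

(** The backward orbit of [y] as seen in [M]. In a nondegenerate lift it
    determines [y] ([trace_inj]), which reduces identities in the lift to
    identities in [M]. *)
Definition trace (y : lift_dos L) (n : nat) : M := E (iter n beta y).

Lemma traceE y n : trace y n = up_comp E (up_iter beta n) y.
Proof. by rewrite /trace /= up_iterE. Qed.

Lemma traceD y z n : trace (y + z) n = trace y n + trace z n.
Proof. by rewrite !traceE linearD. Qed.
Lemma traceZ a y n : trace (a *: y) n = a *: trace y n.
Proof. by rewrite !traceE linearZ. Qed.
Lemma trace_cvg (T : Type) (F : set_system T) (u : T -> lift_dos L) (y : lift_dos L) n :
  Filter F -> u @ F --> y -> (fun t => trace (u t) n) @ F --> trace y n.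
Proof.
move=> FF uy; rewrite traceE; under eq_fun do rewrite traceE.
exact: up_cvg.
Qed.

Lemma lift_map_iter k y : E (iter k alpha y) = iter k phi (E y).
Proof. by elim: k => //= k <-; rewrite -[LHS]/((E \o alpha) _) lift_mapE. Qed.

Lemma iter_beta_alpha j n v : (j <= n)%N ->
  iter j beta (iter n alpha v) = iter (n - j) alpha v.
Proof.
elim: j n => [|j IH] n; first by rewrite subn0.
by case: n => // n jn; rewrite iterSr /= upi_mapK subSS IH.
Qed.

Lemma iter_alpha_beta j n y : (j <= n)%N ->
  iter (n - j) alpha (iter n beta y) = iter j beta y.
Proof.
move=> jn; rewrite -{2}(subnK jn) iterD.
by elim: (n - j)%N => // k IH; rewrite iterSr [iter k.+1 beta _]iterS upi_invK.
Qed.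

Lemma trace_alpha0 y : trace (alpha y) 0 = phi (trace y 0).
Proof. by rewrite /trace /= -[LHS]/((E \o alpha) y) lift_mapE. Qed.
Lemma trace_alphaS y n : trace (alpha y) n.+1 = trace y n.
Proof. by rewrite /trace iterSr upi_mapK. Qed.

Lemma trace_inj : nondegenerate_lift L ->
  forall y z, (forall n, trace y n = trace z n) -> y = z.
Proof.
move=> nd y z yz; apply/eqP; rewrite -subr_eq0; apply/eqP/nd => n.
by rewrite -/(trace _ n) traceD -scaleN1r traceZ yz scaleN1r subrr.
Qed.

End OneLift.

Section TwoLifts.
Variables L1 L2 : reversible_lift phi.
Hypotheses (as1 : asymptotic_lift L1) (as2 : asymptotic_lift L2).
Local Notation N1 := (lift_dos L1).
Local Notation N2 := (lift_dos L2).

(** Both norms in the defining formula are the limit of the same sequence. *)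
Let same_ball_image (y : N1) : dos_ball 1 y ->
  exists2 v, dos_ball 1 v & lift_map L2 v = lift_map L1 y.
Proof.
apply: image_ball_subset => rho; have [_ h1] := as1; have [_ h2] := as2.
by rewrite -(cvg_lim (@Rhausdorff R) (h1 rho)) -(cvg_lim (@Rhausdorff R) (h2 rho)).
Qed.

(** The point [w n] has the backward orbit of [y] up to time [n]; a limit of
    these points in the compact ball has it at all times. *)
Let match_ball (y : N1) : dos_ball 1 y ->
  exists2 w : N2, dos_ball 1 w & forall n, trace w n = trace y n.
Proof.
move=> yb.
have vP n : exists v : N2, dos_ball 1 v /\ lift_map L2 v = trace y n.
  have [|v vb vE] := same_ball_image (y := iter n (upi_inv (lift_aut L1)) y).
    by rewrite -up_iterE; exact: up_ball.
  by exists v.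
have [v {}vP] := choice vP.
pose w n : N2 := iter n (lift_aut L2) (v n).
have wb n : dos_ball 1 (w n).
  by rewrite /w -up_iterE; apply: up_ball; case: (vP n).
have [U [UU Uoo]] := ultraFilterLemma eventually_filter.
have Uw : U (w @^-1` @dos_ball R N2 1) by apply: filterE => n; exact: wb.
have [z zb wz] := dos_ball_ultra_cvg (ultra_fmap w UU) ler01 Uw.
exists z => // j; apply: (@dos_cvg_unique _ _ ((fun n => trace (w n) j) @ U)).
  exact: trace_cvg wz.
apply: cvg_near_cst; apply: Uoo; exists j => // n /= jn.
rewrite /trace /w iter_beta_alpha// lift_map_iter (proj2 (vP n)) /trace.
by rewrite -lift_map_iter iter_alpha_beta.
Qed.

Let match_ball_scaled (r : R) (y : N1) : 0 < r -> dos_ball r y ->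
  exists2 w : N2, dos_ball r w & forall n, trace w n = trace y n.
Proof.
move=> r0 yb; have := dos_ballZ r^-1 yb.
rewrite ger0_norm ?invr_ge0 ?(ltW r0)// mulVf ?gt_eqF//.
move=> /match_ball[w wb wy]; exists (r%:C *: w).
  by have := dos_ballZ r wb; rewrite mulr1 ger0_norm ?(ltW r0).
move=> n; rewrite traceZ wy traceZ scalerA -rmorphM mulfV ?gt_eqF//.
by rewrite rmorph1 scale1r.
Qed.

Let match_sa (y : N1) : dos_sa y -> exists w : N2, forall n, trace w n = trace y n.
Proof.
move=> /dos_sa_ball[r r0 yr].
have r1 : 0 < r + 1 by rewrite ltr_wpDl.
have [|w _ wy] := match_ball_scaled r1 (y := y); last by exists w.
by apply: dos_ball_le yr; rewrite lerDl.
Qed.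

Let match_all (y : N1) : exists w : N2, forall n, trace w n = trace y n.
Proof.
have [A [B [/match_sa[wA hA] /match_sa[wB hB] ->]]] := dos_cartesian y.
by exists (wA + 'i *: wB) => n; rewrite !traceD !traceZ hA hB.
Qed.

Let th (y : N1) : N2 := sval (cid (match_all y)).
Let thP y n : trace (th y) n = trace y n.
Proof. by rewrite /th; case: cid. Qed.

Let th_eq y w : (forall n, trace w n = trace y n) -> th y = w.
Proof. by move=> wy; apply: trace_inj as2.1 _ _ _ => n; rewrite thP. Qed.

Let th_linear : linear th.
Proof.
by move=> a x y; apply: th_eq => n; rewrite !traceD !traceZ !thP.
Qed.

HB.instance Definition _ := GRing.isLinear.Build R[i] N1 N2 _ th th_linear.

Let th_ball (r : R) y : 0 < r -> dos_ball r y -> dos_ball r (th y).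
Proof. by move=> r0 /(match_ball_scaled r0)[w wb /th_eq ->]. Qed.

(** A limit of [th] along an ultrafilter in a ball exists by compactness and is
    identified by its trace, so [th] is continuous on balls. *)
Let th_normal : continuous th.
Proof.
apply: ball_continuous_normal => r F x FU r0 Fr Fx.
have r1 : 0 < r + 1 by rewrite ltr_wpDl.
have Fth : F (th @^-1` @dos_ball R N2 (r + 1)).
  apply: filterS Fr => y yr; have rr1 : r <= r + 1 by rewrite lerDl.
  exact: th_ball r1 (dos_ball_le rr1 yr).
have [w _ Fw] := dos_ball_ultra_cvg (ultra_fmap th FU) (ltW r1) Fth.
suff E : th x = w by move: Fw; rewrite -E.
apply: th_eq => n; apply: (@dos_cvg_unique _ _ ((fun y => trace y n) @ F)).
  have := @trace_cvg L2 _ F th w n _ Fw.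
  by under eq_fun do rewrite thP; apply.
exact: (@trace_cvg L1 _ F id x n _ Fx).
Qed.

Let th_unital : th (dos_one N1) = dos_one N2.
Proof. by apply: th_eq => n; rewrite !traceE !up_unital. Qed.

(** For [0 <= y <= 2 s] the element [s - y] lies in the ball of radius [s], and
    conversely [y] is positive when it does; so a unital map preserving the balls
    preserves positivity. *)
Let th_positive (y : N1) : dos_positive y -> dos_positive (th y).
Proof.
move=> y0; have [r r0 yr] := dos_sa_ball (positive_sa y0).
pose s : R := r + 1; have s0 : 0 < s by rewrite ltr_wpDl.
have ys : dos_ball (s + s) y.
  by apply: dos_ball_le yr; rewrite /s; lra.
have [ys1 _] := (dos_ballE (s + s) y).1 ys.
have xb : dos_ball s (s%:C *: dos_one N1 - y).
  apply/dos_ballE; split; first by rewrite opprB addrCA subrr addr0.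
  by rewrite addrA -scalerDl -rmorphD.
have /dos_ballE[h _] := th_ball s0 xb.
move: h; rewrite linearB linearZ /= th_unital.
by rewrite opprB addrCA subrr addr0.
Qed.

Lemma lift_morphism : exists theta : UPmap N1 N2,
  forall y n, trace (theta y) n = trace y n.
Proof.
by exists (@UPMap R N1 N2 th th_normal th_unital th_positive) => y n; exact: thP.
Qed.

End TwoLifts.

Lemma upiso_eq (N P : dualOperatorSystem R) (f g : UPiso N P) : f =1 g -> f = g.
Proof.
case: f => f f' fK f'K; case: g => g g' gK g'K /= fg.
have E : f = g by exact: upmap_eq.
subst g; have E' : f' = g'.
  by apply: upmap_eq => y; rewrite -{1}(g'K y) fK.
by subst g'; rewrite (Prop_irrelevance fK gK) (Prop_irrelevance f'K g'K).
Qed.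

Lemma asymptotic_lift_unique (L1 L2 : reversible_lift phi) :
  asymptotic_lift L1 -> asymptotic_lift L2 ->
  exists! theta : UPiso (lift_dos L1) (lift_dos L2),
    theta \o lift_aut L1 =1 lift_aut L2 \o theta /\
    lift_map L2 \o theta =1 lift_map L1.
Proof.
move=> as1 as2.
have [t tP] := lift_morphism as1 as2; have [t' t'P] := lift_morphism as2 as1.
have tK : cancel t t'.
  by move=> y; apply: trace_inj as1.1 _ _ _ => n; rewrite t'P tP.
have t'K : cancel t' t.
  by move=> y; apply: trace_inj as2.1 _ _ _ => n; rewrite tP t'P.
exists (UPIso tK t'K); split.
  split=> y /=; last exact: (tP y 0%N).
  apply: trace_inj as2.1 _ _ _ => -[|n]; rewrite tP.
    by rewrite !trace_alpha0 tP.
  by rewrite !trace_alphaS tP.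
move=> s [s_alpha s_E]; apply: upiso_eq => y /=.
apply: trace_inj as2.1 _ _ _ => n; rewrite tP /trace -[LHS]s_E /=; congr (lift_map L2 _).
elim: n => //= n <-.
set z := iter n _ y; rewrite -[LHS](upi_mapK (lift_aut L2)).
by have /= <- := s_alpha (upi_inv (lift_aut L1) z); rewrite upi_invK.
Qed.

End Lifts.

(** * The Hilbert space of square-summable sequences *)

Section SquareSummableSequences.
Variables (R : realType) (H : hilbertSpace R).

Definition ell2_set : set (nat -> H) :=
  [set x | cvgn (series (fun n => rnorm (x n) ^+ 2) : R^nat)].

Definition ell2_pred : {pred nat -> H} := fun x => x \in ell2_set.

Lemma ell2_submod : submod_closed ell2_pred.
Proof.
split=> [|a x y /set_mem xs /set_mem ys]; apply/mem_set.
  apply/cvg_ex; eexists; apply: (@series_eventually_constant _ _ 0) => n _.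
  by rewrite /= rnorm0 expr0n.
apply: (@dominated_series_cvg _ _ (2 *: ((rnorm a ^+ 2 *: (fun n => rnorm (x n) ^+ 2)) +
   (fun n => rnorm (y n) ^+ 2)))).
  move=> n; rewrite ger0_norm ?sqr_ge0// (le_trans (rnormD_sqr_le _ _))//.
  by rewrite rnormcZ exprMn.
by apply: is_cvg_seriesZ; apply: is_cvg_seriesD => //; apply: is_cvg_seriesZ.
Qed.

HB.instance Definition _ :=
  GRing.isSubmodClosed.Build R[i] (nat -> H) ell2_pred ell2_submod.

Record ell2 := Ell2 { ell2_val :> nat -> H; ell2P : ell2_val \in ell2_pred }.

HB.instance Definition _ := [isSub for ell2_val].
HB.instance Definition _ := [Choice of ell2 by <:].
HB.instance Definition _ := [SubChoice_isSubLmodule of ell2 by <:].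

Implicit Types x y z : ell2.

Lemma ell2_addE x y n : (x + y) n = x n + y n.
Proof. by []. Qed.
Lemma ell2_scaleE (a : R[i]) x n : (a *: x) n = a *: x n.
Proof. by []. Qed.
Lemma ell2_eqP x y : (forall n, x n = y n) -> x = y.
Proof. by move=> xy; apply/val_inj/funext. Qed.

Definition ell2_sqs x : sqsummable H := @SqSummable R H x (set_mem (ell2P x)).

Definition ell2_ip x y : R := limn (series (fun n => reip (x n) (y n))).

Lemma ell2_ip_cvg x y : cvgn (series (fun n => reip (x n) (y n)) : R^nat).
Proof. exact: (@uw_cvg _ _ (bop1 H) (ell2_sqs x) (ell2_sqs y)). Qed.

Lemma ell2_ipC x y : ell2_ip x y = ell2_ip y x.
Proof. by congr (limn (series _)); apply/funext => n; rewrite reipC. Qed.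
Lemma ell2_ipDl x y z : ell2_ip (x + y) z = ell2_ip x z + ell2_ip y z.
Proof.
rewrite /ell2_ip -lim_seriesD; [|exact: ell2_ip_cvg|exact: ell2_ip_cvg].
by congr (limn (series _)); apply/funext => n; rewrite ell2_addE reipDl.
Qed.
Lemma ell2_ipDr x y z : ell2_ip z (x + y) = ell2_ip z x + ell2_ip z y.
Proof. by rewrite !(ell2_ipC z) ell2_ipDl. Qed.
Lemma ell2_ipZl (a : R) x y : ell2_ip (a%:C *: x) y = a * ell2_ip x y.
Proof.
rewrite /ell2_ip -[RHS]/(a *: limn (series (fun n => reip (x n) (y n)))).
rewrite -lim_seriesZ; last exact: ell2_ip_cvg.
by congr (limn (series _)); apply/funext => n; rewrite ell2_scaleE reipZl.
Qed.
Lemma ell2_ipZr (a : R) x y : ell2_ip y (a%:C *: x) = a * ell2_ip y x.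
Proof. by rewrite !(ell2_ipC y) ell2_ipZl. Qed.
Lemma ell2_ip_self x : ell2_ip x x = limn (series (fun n => rnorm (x n) ^+ 2)).
Proof. by congr (limn (series _)); apply/funext => n; rewrite rnorm_sqr. Qed.
Lemma ell2_ip_ge0 x : 0 <= ell2_ip x x.
Proof.
rewrite ell2_ip_self; apply: series_ge0; last exact: (set_mem (ell2P x)).
by move=> n; exact: sqr_ge0.
Qed.

Definition ell2_rnorm x : R := Num.sqrt (ell2_ip x x).

Lemma ell2_rnorm_sqr x : ell2_rnorm x ^+ 2 = ell2_ip x x.
Proof. by rewrite sqr_sqrtr// ell2_ip_ge0. Qed.

Lemma ell2_CauchySchwarz x y : ell2_ip x y <= ell2_rnorm x * ell2_rnorm y.
Proof.
apply: discriminant_le; rewrite ?sqrtr_ge0// => s t.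
have := ell2_ip_ge0 (s%:C *: x + (- t)%:C *: y).
rewrite !(ell2_ipDl, ell2_ipDr, ell2_ipZl, ell2_ipZr) (ell2_ipC y x) !ell2_rnorm_sqr.
lra.
Qed.

Lemma ell2_rnormD x y : ell2_rnorm (x + y) <= ell2_rnorm x + ell2_rnorm y.
Proof.
rewrite -ler_sqr ?nnegrE ?addr_ge0 ?sqrtr_ge0// sqrrD !ell2_rnorm_sqr.
rewrite ell2_ipDl !ell2_ipDr (ell2_ipC y x).
have := ell2_CauchySchwarz x y; lra.
Qed.

Lemma ell2_rnorm_coord x n : rnorm (x n) <= ell2_rnorm x.
Proof.
rewrite -ler_sqr ?nnegrE ?rnorm_ge0 ?sqrtr_ge0// ell2_rnorm_sqr ell2_ip_self.
have sx : cvgn (series (fun n => rnorm (x n) ^+ 2) : R^nat) := set_mem (ell2P x).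
have := @series_partial_le R _ n.+1 (fun n => sqr_ge0 _) sx.
apply: le_trans; rewrite seriesSr lerDr.
by rewrite /series /= sumr_ge0// => i _; exact: sqr_ge0.
Qed.

Definition ell2_norm x : R[i] := (ell2_rnorm x)%:C.

Lemma ell2_normD x y : ell2_norm (x + y) <= ell2_norm x + ell2_norm y.
Proof. by rewrite /ell2_norm -rmorphD lecR ell2_rnormD. Qed.

Lemma ell2_normZ (a : R[i]) x : ell2_norm (a *: x) = `|a| * ell2_norm x.
Proof.
rewrite /ell2_norm -(RRe_real (normr_real a)) -rmorphM; congr (_%:C).
rewrite -[complex.Re _]/(rnorm a).
have a0 : 0 <= rnorm a by rewrite rnormcE sqrtr_ge0.
rewrite /ell2_rnorm -[X in X * _](ger0_norm a0) -sqrtr_sqr -sqrtrM ?sqr_ge0//.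
congr Num.sqrt; rewrite !ell2_ip_self.
rewrite -[RHS]/(rnorm a ^+ 2 *: limn (series (fun n => rnorm (x n) ^+ 2))).
rewrite -lim_seriesZ; last exact: (set_mem (ell2P x)).
by congr (limn (series _)); apply/funext => n; rewrite ell2_scaleE rnormcZ exprMn.
Qed.

Lemma ell2_norm_eq0 x : ell2_norm x = 0 -> x = 0.
Proof.
move=> /complexI x0; apply: ell2_eqP => n; apply: rnorm_eq0; apply/eqP.
by rewrite -normr_le0 ger0_norm ?rnorm_ge0// -x0 ell2_rnorm_coord.
Qed.

HB.instance Definition _ := Lmodule_isNormed.Build R[i] ell2
  ell2_normD ell2_normZ ell2_norm_eq0.

Lemma ell2_normE x : `|x| = (ell2_rnorm x)%:C.
Proof. by []. Qed.

Lemma ell2_ballE x (e : R) y : ball x e%:C y <-> ell2_rnorm (x - y) < e.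
Proof. by rewrite -ball_normE /ball_ /= ell2_normE ltcR. Qed.

(** A bound on distances inside a member of [F] passes to the coordinatewise
    limit [z] through partial sums. Completeness uses it twice: to see that [z]
    is square-summable, and that [F] converges to it. *)
Lemma ell2_close_limit (F : set_system ell2) (z : nat -> H) (A : set ell2) (e : R) x :
  ProperFilter F -> (forall n, (fun y : ell2 => y n) @ F --> z n) -> F A ->
  (forall y, A y -> ell2_rnorm (y - x) <= e) ->
  forall N, series (fun n => rnorm (z n - x n) ^+ 2) N <= e ^+ 2.
Proof.
move=> FF Fz FA Ae N.
have lim_sum : (fun y : ell2 => series (fun n => rnorm (y n - x n) ^+ 2) N) @ F -->
    series (fun n => rnorm (z n - x n) ^+ 2) N.
  rewrite /series /=; elim: N => [|N IH].
    by rewrite big_geq//; under eq_fun do rewrite big_geq//; exact: cvg_cst.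
  rewrite big_nat_recr//=; under eq_fun do rewrite big_nat_recr//=.
  apply: cvgD => //; rewrite expr2; under eq_fun do rewrite expr2.
  have h : (fun y : ell2 => rnorm (y N - x N)) @ F --> rnorm (z N - x N).
    by apply: cvg_rnorm; apply: cvgB => //; exact: cvg_cst.
  exact: cvgM.
rewrite -(cvg_lim (@Rhausdorff R) lim_sum); apply: limr_le.
  by apply/cvg_ex; eexists; exact: lim_sum.
apply: filterS FA => y /Ae ye.
have sx : cvgn (series (fun n => rnorm ((y - x) n) ^+ 2) : R^nat) := set_mem (ell2P (y - x)).
apply: le_trans (series_partial_le _ (fun n => sqr_ge0 _) sx) _.
rewrite -ell2_ip_self -ell2_rnorm_sqr ler_sqr ?nnegrE ?sqrtr_ge0//.
exact: le_trans (sqrtr_ge0 _) ye.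
Qed.

Lemma ell2_complete (F : set_system ell2) : ProperFilter F -> cauchy F -> cvg F.
Proof.
move=> FF /cauchy_ballP Fc.
have small (e : R) : 0 < e -> exists2 A, F A &
    forall x y, A x -> A y -> ell2_rnorm (x - y) <= e.
  move=> e0; have e0' : 0 < e%:C by rewrite ltcR.
  have [[A B] /= [FA FB] AB] := Fc _ e0'; exists (A `&` B); first exact: filterI.
  by move=> x y [Ax _] [_ By]; apply/ltW/ell2_ballE; exact: (AB (x, y)).
have coord n : exists l : H, (fun y : ell2 => y n) @ F --> l.
  suff /cvg_ex[l hl] : cvg ((fun y : ell2 => y n) @ F) by exists l.
  apply/cauchy_cvgP/cauchy_ballP => -[e e']; rewrite ltcE/= => /andP[/eqP -> e0].
  have [A FA Ae] := small _ (divr_gt0 e0 (ltr0n _ 2)).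
  pose B : set H := [set y n | y in A].
  have FB : F ((fun y : ell2 => y n) @^-1` B) by apply: filterS FA => y Ay; exists y.
  exists (B, B) => //= -[_ _] [[x Ax <-] [y Ay <-]].
  rewrite -ball_normE /ball_ /= normE ltcR.
  apply: le_lt_trans (ell2_rnorm_coord (x - y) n) _.
  by rewrite (le_lt_trans (Ae _ _ Ax Ay))// ltr_pdivrMr// ltr_pMr// ltr1n.
have [z zP] := choice coord.
have z_ell2 : z \in ell2_pred.
  have [A FA A1] := small 1 ltr01; have [x Ax] := filter_ex FA.
  have d : (fun n => z n - x n) \in ell2_pred.
    apply/mem_set; apply: (@bounded_series_cvg R _ (1 ^+ 2)) => [n|]; first exact: sqr_ge0.
    by apply: (ell2_close_limit FF zP FA) => y Ay; exact: A1.
  have -> : z = (fun n => z n - x n) + x :> (nat -> H).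
    by apply/funext => n; rewrite fctE subrK.
  by apply: rpredD => //; exact: ell2P.
apply/cvg_ex; exists (Ell2 z_ell2); apply/cvgrPdist_le => -[e e'].
rewrite ltcE/= => /andP[/eqP -> e0]; have [A FA Ae] := small _ e0.
apply: filterS (FA) => x Ax; rewrite ell2_normE lecR.
rewrite -ler_sqr ?nnegrE ?sqrtr_ge0 ?(ltW e0)// ell2_rnorm_sqr ell2_ip_self.
have dx : cvgn (series (fun n => rnorm ((Ell2 z_ell2 - x) n) ^+ 2) : R^nat) :=
  set_mem (ell2P _).
apply: limr_le => //; apply: nearW => N.
by apply: (ell2_close_limit FF zP FA) => y Ay; exact: Ae.
Qed.

HB.instance Definition _ := Uniform_isComplete.Build ell2 ell2_complete.

Definition ell2_inner x y : R[i] := ell2_ip x y +i* ell2_ip x ('i *: y).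

Lemma ell2_ip_il x y : ell2_ip ('i *: x) y = - ell2_ip x ('i *: y).
Proof.
rewrite /ell2_ip -lim_seriesN; last exact: (@ell2_ip_cvg x ('i *: y)).
by congr (limn (series _)); apply/funext => n; rewrite !ell2_scaleE reip_il.
Qed.

Lemma ell2_inner_hermitian x y :
  ell2_inner x y = (-1) ^+ false * Num.conj (ell2_inner y x).
Proof.
rewrite expr0 mul1r; apply: complexP; rewrite ?ReJ ?ImJ /=; first exact: ell2_ipC.
by rewrite (ell2_ipC y) ell2_ip_il opprK.
Qed.

Lemma ell2_inner_linearl y : linear_for *%R (ell2_inner ^~ y).
Proof.
move=> a u v; rewrite {1}/ell2_inner (complex_scaleE a u).
rewrite !(ell2_ipDl, ell2_ipZl) !ell2_ip_il scalerA -expr2 sqr_i scaleN1r.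
have -> : ell2_ip u (- y) = - ell2_ip u y.
  by rewrite -scaleN1r -[-1](rmorphN1 (real_complex R)) ell2_ipZr mulN1r.
rewrite opprK; case: a => a b; apply: complexP => /=; ring.
Qed.

Lemma ell2_inner_linearr x : linear_for (Num.conj \; *%R) (ell2_inner x).
Proof.
move=> a u v; rewrite !(ell2_inner_hermitian x) !expr0 !mul1r ell2_inner_linearl.
by rewrite rmorphD rmorphM.
Qed.

HB.instance Definition _ := bilinear_isBilinear.Build R[i] ell2 ell2 R[i]
  *%R (Num.conj \; *%R) ell2_inner (conj ell2_inner_linearl ell2_inner_linearr).

HB.instance Definition _ := isHermitianSesquilinear.Build R[i] ell2 false Num.conj
  ell2_inner ell2_inner_hermitian.

Lemma ell2_inner_self x : ell2_inner x x = (ell2_rnorm x ^+ 2)%:C.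
Proof.
rewrite /ell2_inner ell2_rnorm_sqr; congr (_ +i* _).
have := ell2_ip_il x x; rewrite ell2_ipC; lra.
Qed.

Lemma ell2_inner_gt0 x : x != 0 -> 0 < ell2_inner x x.
Proof.
move=> x0; rewrite ell2_inner_self ltcR exprn_gt0// lt_neqAle sqrtr_ge0 andbT eq_sym.
by apply: contraNN x0 => /eqP x0; apply/eqP/ell2_norm_eq0; rewrite /ell2_norm x0.
Qed.

HB.instance Definition _ := isDotProduct.Build R[i] ell2 ell2_inner ell2_inner_gt0.

Lemma ell2_hilbert_normE x : `|x| ^+ 2 = ell2_inner x x.
Proof. by rewrite ell2_inner_self ell2_normE rmorphXn. Qed.

Definition ell2_hilbert : hilbertSpace R :=
  @HilbertSpace R ell2 ell2_inner ell2_hilbert_normE.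

End SquareSummableSequences.

(** * Block-diagonal operators *)

Section BlockDiagonal.
Variables (R : realType) (H : hilbertSpace R).
Local Notation K := (ell2_hilbert H).

Definition coord (xi : K) (n : nat) : H := (xi : ell2 H) n.

Lemma coordD (xi eta : K) n : coord (xi + eta) n = coord xi n + coord eta n.
Proof. by []. Qed.
Lemma coordZ (a : R[i]) (xi : K) n : coord (a *: xi) n = a *: coord xi n.
Proof. by []. Qed.
Lemma coord_ext (xi eta : K) : (forall n, coord xi n = coord eta n) -> xi = eta.
Proof. exact: ell2_eqP. Qed.
Lemma coord_le (xi : K) n : rnorm (coord xi n) <= rnorm xi.
Proof. exact: ell2_rnorm_coord. Qed.
Lemma reip_coord (xi eta : K) :
  reip xi eta = limn (series (fun n => reip (coord xi n) (coord eta n))).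
Proof. by []. Qed.
Lemma coord_sqr_cvg (xi : K) : cvgn (series (fun n => rnorm (coord xi n) ^+ 2) : R^nat).
Proof. exact: (set_mem (ell2P xi)). Qed.
Lemma rnorm_coord (xi : K) :
  rnorm xi ^+ 2 = limn (series (fun n => rnorm (coord xi n) ^+ 2)).
Proof. by rewrite rnorm_sqr; exact: ell2_ip_self. Qed.
Lemma reip_coord_cvg (xi eta : K) :
  cvgn (series (fun n => reip (coord xi n) (coord eta n)) : R^nat).
Proof. exact: (@ell2_ip_cvg _ _ xi eta). Qed.

Lemma single_subproof (n : nat) (a : H) :
  (fun m => if m == n then a else 0) \in @ell2_pred R H.
Proof.
apply/mem_set/cvg_ex; eexists; apply: (@series_eventually_constant _ _ n.+1) => m nm.
by rewrite gtn_eqF// rnorm0 expr0n.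
Qed.

Definition single (n : nat) (a : H) : K := Ell2 (single_subproof n a).

Lemma coord_single n a m : coord (single n a) m = if m == n then a else 0.
Proof. by []. Qed.

Lemma reip_single xi n a : reip xi (single n a) = reip (coord xi n) a.
Proof.
rewrite reip_coord; apply: (cvg_lim (@Rhausdorff R)).
have -> : reip (coord xi n) a =
    series (fun m => reip (coord xi m) (coord (single n a) m)) n.+1.
  rewrite seriesSr coord_single eqxx /series /= big_nat big1 ?add0r// => m /andP[_ mn].
  by rewrite ltn_eqF// reip0r.
by apply: series_eventually_constant => m nm; rewrite coord_single gtn_eqF// reip0r.
Qed.

Lemma single_linear n (c : R[i]) a b :
  single n (c *: a + b) = c *: single n a + single n b.
Proof.
apply: coord_ext => m; rewrite coordD coordZ !coord_single.
by case: eqP => _; rewrite // scaler0 addr0.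
Qed.

Lemma single_scale n (c : R[i]) a : single n (c *: a) = c *: single n a.
Proof.
apply: coord_ext => m; rewrite coordZ !coord_single.
by case: eqP => _; rewrite // scaler0.
Qed.

Lemma rnorm_single n a : rnorm (single n a) = rnorm a.
Proof.
apply/eqP; rewrite -(@eqrXn2 _ 2) ?rnorm_ge0//.
by rewrite !rnorm_sqr reip_single coord_single eqxx.
Qed.

Lemma single_le n a : rnorm (single n a) <= 1 * rnorm a.
Proof. by rewrite rnorm_single mul1r. Qed.

Lemma block_mem (T : bop K) n :
  (fun a => coord (T (single n a)) n) \in @bounded_operator_pred R H.
Proof.
have [C _ TC] := bop_bounded T; apply: (@bounded_operator_mem _ _ _ C).
  by move=> c a b; rewrite single_linear bop_D bop_Z.
by move=> a; rewrite (le_trans (coord_le _ _))// (le_trans (TC _))// rnorm_single.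
Qed.

Definition block (n : nat) (T : bop K) : bop H := Bop (block_mem T n).

Lemma blockE n T a : block n T a = coord (T (single n a)) n.
Proof. by []. Qed.

Lemma reip_block n T a b : reip (block n T a) b = reip (T (single n a)) (single n b).
Proof. by rewrite reip_single. Qed.

Lemma uw_block n T a b :
  uw (block n T) a b = uw T (sqs_map (single_le n) a) (sqs_map (single_le n) b).
Proof. by congr (limn (series _)); apply/funext => k; rewrite reip_block. Qed.

Lemma block_cvg n (F : set_system (bop K)) (T : bop K) : Filter F ->
  F --> T -> (block n : bop K -> bop H) @ F --> block n T.
Proof.
move=> FF /bop_cvgP FT; apply/bop_cvgP => a b.
have := FT (sqs_map (single_le n) a) (sqs_map (single_le n) b).
by rewrite -uw_block; under eq_fun do rewrite -uw_block.
Qed.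

(** The blocks are stated by their action on coordinates, which makes the
    off-diagonal blocks vanish and the diagonal ones unique. *)
Definition block_diagonal (T : bop K) (x : nat -> bop H) :=
  forall xi n, coord (T xi) n = x n (coord xi n).

Lemma block_diagonal_block T x n : block_diagonal T x -> block n T = x n.
Proof. by move=> Tx; apply: bop_eqP => a; rewrite blockE Tx coord_single eqxx. Qed.

Lemma block_diagonal_inj S T x : block_diagonal S x -> block_diagonal T x -> S = T.
Proof. by move=> Sx Tx; apply: bop_eqP => xi; apply: coord_ext => n; rewrite Sx Tx. Qed.

Lemma block_diagonal_le T x (C : R) : block_diagonal T x ->
  (forall xi, rnorm (T xi) <= C * rnorm xi) -> forall n a, rnorm (x n a) <= C * rnorm a.
Proof.
move=> Tx TC n a; rewrite -(block_diagonal_block n Tx) blockE.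
by rewrite (le_trans (coord_le _ _))// (le_trans (TC _))// rnorm_single.
Qed.

Lemma block_diagonal_adjoint S T x y : block_diagonal S x -> block_diagonal T y ->
  (forall n, is_adjoint (x n) (y n)) -> is_adjoint S T.
Proof.
move=> Sx Ty xy; apply/is_adjointP => xi eta; rewrite !reip_coord.
congr (limn (series _)); apply/funext => n; rewrite Sx Ty.
by move/is_adjointP: (xy n); apply.
Qed.

Lemma adjoint_block_diagonal S T x y : block_diagonal S x ->
  (forall n, is_adjoint (x n) (y n)) -> is_adjoint S T -> block_diagonal T y.
Proof.
move=> Sx xy /is_adjointP ST xi n; apply: reip_ext => a.
rewrite -reip_single reipC -ST reipC.
rewrite (_ : S (single n a) = single n (x n a)); last first.
  by apply: coord_ext => m; rewrite Sx !coord_single; case: eqP => [->//|_]; exact: bop_0.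
by rewrite reip_single; symmetry; move/is_adjointP: (is_adjoint_sym (xy n)); apply.
Qed.

Lemma block_diagonal_exists (x : nat -> bop H) (r : R) :
  (forall n a, rnorm (x n a) <= r * rnorm a) -> exists T, block_diagonal T x.
Proof.
move=> xr.
have r2 xi n : `|rnorm (x n (coord xi n)) ^+ 2| <=
    (r ^+ 2 *: (fun n => rnorm (coord xi n) ^+ 2)) n.
  rewrite ger0_norm ?sqr_ge0// fctE /GRing.scale/= -exprMn.
  by rewrite ler_sqr ?nnegrE ?rnorm_ge0// (le_trans (rnorm_ge0 _) (xr _ _)).
have dom_cvg (xi : K) : cvgn (series (r ^+ 2 *: (fun n => rnorm (coord xi n) ^+ 2)) : R^nat).
  by apply: is_cvg_seriesZ; exact: (@coord_sqr_cvg xi).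
have mem (xi : K) : (fun n => x n (coord xi n)) \in @ell2_pred R H.
  by apply/mem_set; exact: dominated_series_cvg (r2 xi) (@dom_cvg xi).
pose f (xi : K) : K := Ell2 (mem xi).
have fl : linear f.
  by move=> a xi eta; apply: coord_ext => n; rewrite coordD coordZ /coord /= bop_D bop_Z.
have fr xi : rnorm (f xi) <= `|r| * rnorm xi.
  rewrite -ler_sqr ?nnegrE ?mulr_ge0 ?rnorm_ge0// exprMn real_normK ?num_real//.
  rewrite !rnorm_coord -[leRHS]/(r ^+ 2 *: limn (series (fun n => rnorm (coord xi n) ^+ 2))).
  rewrite -lim_seriesZ; last exact: (@coord_sqr_cvg xi).
  apply: le_trans (ler_norm _) _.
  exact: dominated_series_le (r2 xi) (@dom_cvg xi).
by exists (mkbop fl fr).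
Qed.

End BlockDiagonal.

(** * The inverse limit *)

Section InverseLimit.
Variables (R : realType) (M : dualOperatorSystem R) (phi : UPmap M M).
Local Notation H := (dos_space M).
Local Notation K := (ell2_hilbert H).

Definition coherent (x : nat -> M) := forall n, phi (x n.+1) = x n.

Definition diagonal_of (T : bop K) (x : nat -> M) :=
  block_diagonal T (fun n => x n : bop H).

(** The inverse limit of [M] along [phi], represented on a single Hilbert space so
    that its order, norm and ultraweak topology are those of operators. *)
Definition ilim_set : set (bop K) :=
  [set T | exists2 x, coherent x & diagonal_of T x].

Lemma ilim_submod : submod_closed (mem ilim_set).
Proof.
split=> [|a S T /set_mem[x xc Sx] /set_mem[y yc Ty]]; apply/mem_set.
  by exists (fun=> 0) => // n; exact: linear0.
exists (fun n => a *: x n + y n) => [n|xi n].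
  by rewrite linearD linearZ /= xc yc.
by rewrite bop_addE bop_scaleE coordD coordZ Sx Ty.
Qed.

Lemma ilim_adjoint_coherent (x y : nat -> M) : coherent x -> (forall n, is_adjoint (x n) (y n)) ->
  coherent y.
Proof.
move=> xc xy n; apply: dos_eqP; apply: adjoint_unique (xy n).
by rewrite -xc; exact: up_adjoint.
Qed.

Lemma ilim_selfadjoint :
  [set S | exists2 T, ilim_set T & is_adjoint T S] = ilim_set.
Proof.
apply/seteqP; split=> [S [T [x xc Tx] TS]|S [x xc Sx]].
  have [y xy] := choice (fun n => dos_adjoint (x n)).
  exists y; first exact: ilim_adjoint_coherent xy.
  exact: adjoint_block_diagonal Tx xy TS.
have [y xy] := choice (fun n => dos_adjoint (x n)).
have [C _ SC] := bop_bounded S.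
have yC n a : rnorm ((y n : bop H) a) <= C * rnorm a.
  by apply: adjoint_rnorm_le (xy n) _ _; exact: block_diagonal_le Sx SC _.
have [T Ty] := block_diagonal_exists yC.
exists T; first by exists y => //; exact: ilim_adjoint_coherent xy.
by apply: block_diagonal_adjoint Ty Sx _ => n; exact: is_adjoint_sym.
Qed.

Lemma ilim_unit : ilim_set (bop1 K).
Proof. by exists (fun=> dos_one M) => // n; exact: up_unital. Qed.

(** The blocks depend continuously on the operator, [phi] is normal, and
    being block-diagonal is tested on matrix coefficients: each condition
    survives an ultraweak limit. *)
Lemma ilim_closed : closed ilim_set.
Proof.
move=> T; rewrite closureEcvg => -[F FF [FT Fset]].
have Fi : F ilim_set by exact: Fset.
have blockM n : dos_set M (block n T).
  have nearM : F (fun S => dos_set M (block n S)).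
    apply: filterS (Fi) => S [x _ Sx]; rewrite (block_diagonal_block n Sx).
    exact: set_mem (dos_valP _).
  exact: (@closed_cvg _ (bop H) F _ (block n) (dos_set M) (dos_closed M) nearM
    _ (@block_cvg _ _ n F T _ FT)).
pose x n : M := DosElt (mem_set (blockM n)).
(* The block of an operator as an element of [M]; the default value [0] occurs
   outside [ilim_set] only. *)
pose u n (S : bop K) : M := insubd (0 : M) (block n S).
have uE S y n : diagonal_of S y -> u n S = y n.
  move=> Sy; apply: dos_eqP; rewrite -[LHS]/(val (u n S)) /u val_insubd.
  by rewrite (block_diagonal_block n Sy) dos_valP.
have ux n : u n @ F --> x n.
  apply: (dos_cvg_val (x n) (fmap_filter (u n) FF)).2.
  apply: cvg_trans (@block_cvg _ _ n F T _ FT).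
  apply: (@near_eq_cvg _ _ F _ (block n) (fun S => u n S : bop H)).
  apply: filterS (Fi) => S [y _ Sy].
  by rewrite (uE _ _ _ Sy) (block_diagonal_block n Sy).
exists x => [n|xi n].
  apply: (@dos_cvg_unique _ _ ((fun S => phi (u n.+1 S)) @ F)); first exact: up_cvg.
  apply: cvg_trans (ux n); apply: near_eq_cvg.
  by apply: filterS (Fi) => S [y yc Sy] /=; rewrite !(uE _ _ _ Sy) yc.
apply: reip_ext => a; rewrite blockE -!reip_single.
have FF' : Filter F by exact: filter_filter.
have h1 := @bop_cvg_reip _ _ F T xi (single n a) FF' FT.
have h2 := @bop_cvg_reip _ _ F T (single n (coord xi n)) (single n a) FF' FT.
rewrite -(cvg_lim (@Rhausdorff R) h2); apply/esym/(cvg_lim (@Rhausdorff R)).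
apply: cvg_trans h1; apply: near_eq_cvg; apply: filterS (Fi) => S [y _ Sy].
by rewrite !reip_single !Sy coord_single eqxx.
Qed.

Definition ilim : dualOperatorSystem R :=
  @DualOperatorSystem R K ilim_set ilim_submod ilim_selfadjoint ilim_unit ilim_closed.

Lemma ilim_exists (x : nat -> M) (r : R) : coherent x ->
  (forall n a, rnorm ((x n : bop H) a) <= r * rnorm a) ->
  exists y : ilim, diagonal_of y x.
Proof.
move=> xc /block_diagonal_exists[T Tx].
have Ti : ilim_set T by exists x.
by exists (@DosElt R ilim T (mem_set Ti)).
Qed.

Lemma ilim_blocks (y : ilim) : exists2 x, coherent x & diagonal_of y x.
Proof. exact: (set_mem (dos_valP y)). Qed.

Definition component (n : nat) (y : ilim) : M :=
  (s2val (cid2 (ilim_blocks y))) n.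

Lemma componentP (y : ilim) : diagonal_of y (fun n => component n y).
Proof. exact: (s2valP' (cid2 (ilim_blocks y))). Qed.

Lemma component_coherent (y : ilim) : coherent (fun n => component n y).
Proof. exact: (s2valP (cid2 (ilim_blocks y))). Qed.

Lemma componentE (y : ilim) x n : diagonal_of y x -> component n y = x n.
Proof.
move=> yx; apply: dos_eqP.
by rewrite -(block_diagonal_block n yx) -(block_diagonal_block n (componentP y)).
Qed.

Lemma component_block (y : ilim) n : component n y = block n y :> bop H.
Proof. by rewrite (block_diagonal_block n (componentP y)). Qed.

Lemma component_inj (y z : ilim) : (forall n, component n y = component n z) -> y = z.
Proof.
move=> yz; apply/dos_eqP/(block_diagonal_inj (componentP y)).
by move=> xi n; rewrite (componentP z) yz.
Qed.

Lemma component_linear n : linear (component n).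
Proof.
move=> a y z; apply: (@componentE _ (fun n => a *: component n y + component n z)).
move=> xi k; rewrite dos_addE dos_scaleE coordD coordZ.
by rewrite (componentP y) (componentP z).
Qed.

HB.instance Definition _ n := GRing.isLinear.Build R[i] ilim M _ (component n)
  (component_linear n).

Lemma component_normal n : continuous (component n).
Proof.
apply: dos_continuous => y a b.
have E z : uw (component n z) a b =
    uw z (sqs_map (@single_le _ _ n) a) (sqs_map (@single_le _ _ n) b).
  by rewrite component_block uw_block.
rewrite (funext E) E; exact: (@uw_continuous R ilim _ _ y).
Qed.

Lemma component_unital n : component n (dos_one ilim) = dos_one M.
Proof. by apply: (@componentE _ (fun=> dos_one M)). Qed.

Lemma component_positive n (y : ilim) : dos_positive y -> dos_positive (component n y).
Proof.
move=> /bop_positiveP y0; apply/bop_positiveP => a; rewrite component_block.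
have [h1 h2] := y0 (single n a); rewrite !reip_block; split=> //.
by rewrite single_scale.
Qed.

Definition ilim_proj n : UPmap ilim M :=
  @UPMap R ilim M (component n) (@component_normal n) (component_unital n)
    (@component_positive n).

Lemma positive_components (y : ilim) :
  (forall n, dos_positive (component n y)) -> dos_positive y.
Proof.
move=> yp; apply/bop_positiveP => xi; split.
  rewrite reip_coord; apply: series_ge0; last exact: (@reip_coord_cvg _ _ _ xi).
  by move=> n; rewrite (componentP y); have /bop_positiveP/(_ (coord xi n))[] := yp n.
rewrite reip_coord (_ : (fun n => _) = (fun=> 0)).
  by rewrite (_ : series _ = (fun=> 0)) ?lim_cst//; apply/funext => n; rewrite /series /= big1.
apply/funext => n; rewrite (componentP y) coordZ.
by have /bop_positiveP/(_ (coord xi n))[] := yp n.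
Qed.

Lemma ball_components (r : R) (y : ilim) :
  (forall n, dos_ball r (component n y)) -> dos_ball r y.
Proof.
move=> yb; apply/dos_ballE; split; apply: positive_components => n;
  have /dos_ballE[h1 h2] := yb n.
  by rewrite linearB linearZ /= component_unital.
by rewrite linearD linearZ /= component_unital.
Qed.

Section UniversalProperty.
Variables (P : dualOperatorSystem R) (f : nat -> UPmap P M).
Hypothesis f_coherent : forall y n, phi (f n.+1 y) = f n y.

Let lift_exists y : exists z : ilim, forall n, component n z = f n y.
Proof.
have [A [B [Asa Bsa ->]]] := dos_cartesian y.
have [r _ Ar] := dos_sa_ball Asa; have [s _ Bs] := dos_sa_ball Bsa.
have [n|n a|z zP] := @ilim_exists (fun n => f n (A + 'i *: B)) (r + s).
- exact: f_coherent.
- have -> : f n (A + 'i *: B) = f n A + 'i *: f n B by rewrite linearD linearZ.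
  rewrite dos_addE dos_scaleE mulrDl.
  rewrite (le_trans (rnormD _ _))// rnorm_i lerD//.
    exact: (sa_ball_rnorm _ (up_ball (f n) Ar)).
  exact: (sa_ball_rnorm _ (up_ball (f n) Bs)).
by exists z => n; exact: componentE zP.
Qed.

Let g (y : P) : ilim := sval (cid (lift_exists y)).
Let gP y n : component n (g y) = f n y.
Proof. by rewrite /g; case: cid. Qed.

Let g_linear : linear g.
Proof.
move=> a x y; apply: component_inj => n.
by rewrite linearD linearZ /= !gP linearD linearZ.
Qed.

HB.instance Definition _ := GRing.isLinear.Build R[i] P ilim _ g g_linear.

Let g_normal : continuous g.
Proof.
apply: ball_continuous_normal => r F x FU r0 Fr Fx.
have Fg : F (g @^-1` @dos_ball R ilim r).
  apply: filterS Fr => y yr; apply: ball_components => n.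
  by rewrite gP; exact: up_ball.
have [w _ Fw] := dos_ball_ultra_cvg (ultra_fmap g FU) r0 Fg.
suff E : g x = w by move: Fw; rewrite -E.
apply: component_inj => n; rewrite gP.
apply: (@dos_cvg_unique _ _ ((fun y => f n y) @ F)); first exact: (up_cvg (u := id)).
have := @up_cvg _ _ _ (ilim_proj n) _ F g w _ Fw => /=.
by under eq_fun do rewrite gP; apply.
Qed.

Let g_unital : g (dos_one P) = dos_one ilim.
Proof. by apply: component_inj => n; rewrite gP up_unital component_unital. Qed.

Let g_positive y : dos_positive y -> dos_positive (g y).
Proof.
by move=> y0; apply: positive_components => n; rewrite gP; exact: up_positive.
Qed.

(** The universal property of the inverse limit. Normality costs nothing: an
    ultrafilter limit in a ball is identified by its components, so the induced
    map is continuous on balls. *)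
Lemma ilim_universal : exists h : UPmap P ilim, forall y n, component n (h y) = f n y.
Proof. by exists (@UPMap R P ilim g g_normal g_unital g_positive) => y n; exact: gP. Qed.

End UniversalProperty.

End InverseLimit.

(** * Existence of the asymptotic lift *)

Section Existence.
Variables (R : realType) (M : dualOperatorSystem R) (phi : UPmap M M).
Local Notation N := (ilim phi).

(** Given [x k] in the ball with [rho (phi^k (x k))] large, the limits of
    [phi^(k - j) (x k)] along an ultrafilter in [k] form a coherent sequence in
    the ball, by compactness and normality of [phi]. *)
Lemma ilim_norm_attained (rho : predual M) (c : R) :
  (forall k, exists2 x, dos_ball 1 x & c <= rnorm (rho (iter k phi x))) ->
  exists2 y : N, dos_ball 1 y & c <= rnorm (rho (component 0 y)).
Proof.
move=> almost.
have xP k : exists x, dos_ball 1 x /\ c <= rnorm (rho (iter k phi x)).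
  by have [x] := almost k; exists x.
have [x {}xP] := choice xP.
have [U [UU Uoo]] := ultraFilterLemma eventually_filter.
have FU : Filter U by exact: filter_filter.
have limz j : exists z, dos_ball 1 z /\ (fun k => iter (k - j) phi (x k)) @ U --> z.
  have Ub : U ((fun k => iter (k - j) phi (x k)) @^-1` @dos_ball R M 1).
    by apply: filterE => k; rewrite /= -up_iterE; apply: up_ball; case: (xP k).
  by have [z zb h] := dos_ball_ultra_cvg (ultra_fmap _ UU) ler01 Ub; exists z.
have [z zP] := choice limz.
have z_coherent : coherent phi z.
  move=> j; apply: (@dos_cvg_unique _ _ ((fun k => phi (iter (k - j.+1) phi (x k))) @ U)).
    by apply: up_cvg; case: (zP j.+1).
  apply: cvg_trans (proj2 (zP j)).
  apply: (@near_eq_cvg _ _ U _ (fun k => iter (k - j) phi (x k))).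
  by apply: Uoo; exists j.+1 => // k /= jk; rewrite -iterS -subSn.
have [n a|y yz] := ilim_exists (r := 1) z_coherent.
  by apply: sa_ball_rnorm; case: (zP n).
have yE n : component n y = z n by exact: componentE yz.
exists y; first by apply: ball_components => n; rewrite yE; case: (zP n).
rewrite yE.
have lim_rho : (fun k => rnorm (rho (iter k phi (x k)))) @ U --> rnorm (rho (z 0%N)).
  have rho_lim : (fun k => rho (iter k phi (x k)) : R[i]^o) @ U --> (rho (z 0%N) : R[i]^o).
    have [_ +] := zP 0%N; under eq_fun do rewrite subn0.
    by move=> h; exact: cvg_comp h (@predual_normal _ _ rho (z 0%N)).
  exact: cvg_rnormc rho_lim.
rewrite -(cvg_lim (@Rhausdorff R) lim_rho); apply: limr_ge.
  by apply/cvg_ex; eexists; exact: lim_rho.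
by apply: filterE => k; case: (xP k).
Qed.

(** The norms decrease in [k] and stay above the norm on the inverse limit, as
    [component 0 y] is [phi^k] of [component k y]; a gap between their limit and
    the latter would contradict [ilim_norm_attained]. *)
Lemma ilim_norm_formula (rho : predual M) :
  (fun k => sa_norm (rho \o iter k phi)) @ \oo --> sa_norm (rho \o ilim_proj phi 0).
Proof.
pose c k := sa_norm (rho \o iter k phi).
have cE k : c k = sa_norm (rho \o up_iter phi k).
  by congr sa_norm; apply/funext => x; rewrite /= up_iterE.
have c_ge k x : dos_ball 1 x -> rnorm (rho (iter k phi x)) <= c k.
  by move=> xb; rewrite cE -up_iterE; exact: sa_norm_ge.
have c_noninc k m : (k <= m)%N -> c m <= c k.
  move=> km; apply: sa_norm_le => x xb; rewrite /= -(subnKC km) iterD.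
  by apply: c_ge; rewrite -up_iterE; exact: up_ball.
set L := sa_norm _.
have Lc k : L <= c k.
  apply: sa_norm_le => y yb; rewrite /=.
  have -> : component 0 y = iter k phi (component k y).
    by elim: k => // k ->; rewrite iterSr component_coherent.
  by apply: c_ge; exact: (up_ball (ilim_proj phi k)).
apply/cvgrPdist_le => e e0.
suff [K cK] : exists K, c K <= L + e.
  exists K => // k /= Kk; rewrite distrC ger0_norm ?subr_ge0 ?Lc//.
  by rewrite lerBlDl (le_trans (c_noninc _ _ Kk)).
apply: contrapT => no.
have [k|y yb ye] := @ilim_norm_attained rho (L + e).
  apply: contrapT => nx; apply: no; exists k; apply: sa_norm_le => x xb.
  by rewrite leNgt; apply/negP => xe; apply: nx; exists x => //; exact: ltW.
have := le_trans ye (sa_norm_ge rho (ilim_proj phi 0) yb); rewrite -/L; lra.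
Qed.

(** Both maps come from the universal property: [alpha] applies [phi] to each
    component, [beta] shifts the components. *)
Lemma asymptotic_lift_exists : exists L : reversible_lift phi, asymptotic_lift L.
Proof.
have [y n|alpha alphaP] := ilim_universal (phi := phi)
  (f := fun n => up_comp phi (ilim_proj phi n)).
  by rewrite /= component_coherent.
have [y n|beta betaP] := ilim_universal (phi := phi) (f := fun n => ilim_proj phi n.+1).
  exact: component_coherent.
have alphaK : cancel alpha beta.
  by move=> y; apply: component_inj => n; rewrite betaP /= alphaP /= component_coherent.
have betaK : cancel beta alpha.
  by move=> y; apply: component_inj => n; rewrite alphaP /= betaP /= component_coherent.
have liftE : ilim_proj phi 0 \o UPIso alphaK betaK =1 phi \o ilim_proj phi 0.
  by move=> y; rewrite /= alphaP.
exists (@ReversibleLift R M phi N (UPIso alphaK betaK) (ilim_proj phi 0) liftE).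
split=> [y|rho]; last exact: ilim_norm_formula.
have iterE n k : component k (iter n beta y) = component (k + n) y.
  by elim: n k => [|n IH] k; rewrite ?addn0//= betaP /= IH addSnnS.
move=> y0; apply: component_inj => n; have := y0 n.
by rewrite /= iterE add0n => ->; rewrite linear0.
Qed.

End Existence.

Theorem theorem2p5 (R : realType) (M : dualOperatorSystem R)
    (phi : UPmap M M) :
  (exists L : reversible_lift phi, asymptotic_lift L) /\
  (forall L1 L2 : reversible_lift phi,
     asymptotic_lift L1 -> asymptotic_lift L2 ->
     exists! theta : UPiso (lift_dos L1) (lift_dos L2),
       theta \o lift_aut L1 =1 lift_aut L2 \o theta /\
       lift_map L2 \o theta =1 lift_map L1).
Proof.
by split; [exact: asymptotic_lift_exists|exact: asymptotic_lift_unique].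
Qed.
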